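(* Let $G$ be a finite simple connected graph which is complete intersection and which has exactly two non-bipartite blocks $B_1,B_2$. Let $y_{1,2}$ be the cut vertex of $B_1$ lying on the unique path from $B_1$ to $B_2$ in the block tree of $G$, and $y_{2,1}$ the cut vertex of $B_2$ lying on that path. Then: each of $B_1,B_2$ contains at most two odd chordless cycles; $B_1$ contains exactly one odd chordless cycle passing through $y_{1,2}$, and $B_2$ contains exactly one odd chordless cycle passing through $y_{2,1}$; and if $B_1$ (resp. $B_2$) contains another odd chordless cycle, then this cycle has distance one from $y_{1,2}$ (resp. $y_{2,1}$), i.e. it does not contain that vertex but contains a vertex adjacent to it.
   Context: For a finite simple graph $G$ with edges $e_1,\dots,e_m$ and a field $K$, the toric ideal $I_G\subseteq K[e_1,\dots,e_m]$ is the kernel of the $K$-algebra map $e_i=\{v_j,v_k\}\mapsto v_jv_k$; $G$ is complete intersection if $I_G$ is generated by $\operatorname{ht}(I_G)$ elements. A block is a maximal biconnected subgraph of $G$. The block tree of $G$ is the bipartite graph whose vertices are the blocks and the cut vertices of $G$, with a block $B$ adjacent to a cut vertex $v$ iff $v\in B$. A cycle is chordless if no edge of $G$ joins two of its vertices other than its own edges. *)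

(* Defs.v *)
From HB Require Import structures.
From mathcomp Require Import all_boot all_order all_algebra.
Unset Printing Implicit Defensive.
Import GRing.Theory.
Local Open Scope ring_scope.

(* mpoly K n = K[x_0,...,x_{n-1}], x_{n-1} being the outermost variable. *)
Fixpoint mpoly (K : fieldType) (n : nat) : comNzRingType :=
  if n is n'.+1 then ({poly mpoly K n'} : comNzRingType) else K.

Fixpoint mconst (K : fieldType) (n : nat) : K -> mpoly K n :=
  match n return K -> mpoly K n with
  | 0 => fun c => c
  | n'.+1 => fun c => (mconst K n' c)%:P
  end.

(* the variable x_i (i < n); 0 if i >= n *)
Fixpoint mvar (K : fieldType) (n : nat) (i : nat) : mpoly K n :=
  match n return mpoly K n with
  | 0 => 0
  | n'.+1 => if i == n' then 'X else (mvar K n' i)%:P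
  end.

Fixpoint meval (K : fieldType) (S : comNzRingType) (f : K -> S) (a : nat -> S)
  (n : nat) : mpoly K n -> S :=
  match n return mpoly K n -> S with
  | 0 => f
  | n'.+1 => fun p => (map_poly (meval K S f a n') p).[a n']
  end.

Set Implicit Arguments. Unset Strict Implicit.

Section Ideals.
Variable R : comNzRingType.

Definition is_ideal (I : R -> Prop) : Prop :=
  [/\ I 0, (forall x y, I x -> I y -> I (x + y)) & (forall r x, I x -> I (r * x))].

Definition is_prime_ideal (P : R -> Prop) : Prop :=
  [/\ is_ideal P, ~ P 1 & (forall x y, P (x * y) -> P x \/ P y)].

Definition ideal_sub (I J : R -> Prop) : Prop := forall x, I x -> J x.

Definition ideal_ssub (I J : R -> Prop) : Prop :=
  ideal_sub I J /\ exists x, J x /\ ~ I x.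

Definition generated_by (I : R -> Prop) (g : seq R) : Prop :=
  forall x, I x <-> exists c : nat -> R, x = \sum_(i < size g) c i * g`_i.

Definition prime_chain_to (P : R -> Prop) (h : nat) : Prop :=
  exists Q : nat -> (R -> Prop),
    [/\ forall i, i <= h -> is_prime_ideal (Q i),
        forall i, i < h -> ideal_ssub (Q i) (Q i.+1)
      & forall x, Q h x <-> P x]%N.

Definition prime_height (P : R -> Prop) (h : nat) : Prop :=
  prime_chain_to P h /\ ~ prime_chain_to P h.+1.

Definition ideal_height (I : R -> Prop) (h : nat) : Prop :=
  (exists P, [/\ is_prime_ideal P, ideal_sub I P & prime_height P h]) /\
  (forall P k, is_prime_ideal P -> ideal_sub I P -> prime_height P k -> (h <= k)%N).

Definition complete_intersection (I : R -> Prop) : Prop :=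
  exists g : seq R, generated_by I g /\ ideal_height I (size g).
End Ideals.

(* Finite simple graphs: a symmetric irreflexive relation e on T.      *)
Section Graphs.
Variable T : finType.
Variable e : rel T.

Definition gedges : {set {set T}} :=
  [set E | [exists x, exists y, e x y && (E == [set x; y])]].

(* toric ideal of the graph: kernel of K[e_1..e_m] -> K[v_1..v_n],
   e_i = {v_j,v_k} |-> v_j v_k *)
Definition edge_image (K : fieldType) (i : nat) : mpoly K #|T| :=
  if insub i is Some j then
    \prod_(v in @enum_val _ (mem gedges) j) mvar K #|T| (enum_rank v)
  else 0.

Definition toric_map (K : fieldType) : mpoly K #|gedges| -> mpoly K #|T| :=
  meval K _ (mconst K #|T|) (@edge_image K) #|gedges|.

Definition toric_ideal (K : fieldType) : mpoly K #|gedges| -> Prop :=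
  fun p => toric_map p = 0.

Definition graph_CI (K : fieldType) : Prop :=
  complete_intersection (@toric_ideal K).

Definition induced (S : {set T}) : rel T :=
  [rel x y | [&& x \in S, y \in S & e x y]].

Definition connected_in (S : {set T}) : bool :=
  [forall x in S, forall y in S, connect (induced S) x y].

Definition gconnected : bool := connected_in [set: T].

Definition biconnected (S : {set T}) : bool :=
  [&& (1 < #|S|)%N, connected_in S & [forall v in S, connected_in (S :\ v)]].

Definition is_block (B : {set T}) : bool :=
  biconnected B && [forall S : {set T}, (B \proper S) ==> ~~ biconnected S].

Definition is_cut (v : T) : bool := ~~ connected_in ([set: T] :\ v).

Definition bipartite_in (S : {set T}) : Prop :=
  exists f : T -> bool, forall x y, x \in S -> y \in S -> e x y -> f x != f y.

Definition btree_adj : rel ({set T} + T) :=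
  fun a b => match a, b with
  | inl B, inr v => [&& is_block B, is_cut v & v \in B]
  | inr v, inl B => [&& is_block B, is_cut v & v \in B]
  | _, _ => false
  end.

(* chordless cycles, identified with their vertex set *)
Definition chordless_cycle_seq (s : seq T) : bool :=
  [&& uniq s, (2 < size s)%N, cycle e s &
      all (fun x => all (fun y => e x y ==> ((y == next s x) || (x == next s y))) s) s].

Definition odd_chordless_cycle (C : {set T}) : Prop :=
  exists s : seq T, [/\ chordless_cycle_seq s, odd (size s) & C = [set x in s]].
End Graphs.

(* Main.v *)
Require Import Defs.
From HB Require Import structures.
From mathcomp Require Import all_boot all_order all_algebra.
From mathcomp Require Import boolp zify lra.
From mathcomp Require mpoly cardinality finmap.
Set Implicit Arguments. Unset Strict Implicit. Unset Printing Implicit Defensive.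
Import Order.TTheory GRing.Theory Num.Theory.

(* If I_G is a complete intersection, it has a binomial generating set U whose
   exponent vectors are linearly independent: the classes of the minimal binomials
   are independent in I_G / m I_G, so there are at most
   ht I_G <= #edges - rank(incidence matrix) of them (a count of transcendence
   degrees along a chain of primes), while they span the lattice of relations.
   Moreover two monomials of the same degree b differ by a combination of elements
   of U of degree <= b; in particular a relation carried by an induced subgraph is
   a combination of elements of U carried by it.

   Let y = y12 and let H be the side of y containing B1. By independence, exactly
   one element of U has nonzero sum at y when restricted to H, and its degree is
   below the degree of every binomial with this property. Two odd closed walks based
   at y, one on each side, give such a binomial. Since B1 is biconnected, an odd
   cycle C of B1 can be reached from y avoiding any given vertex; so the restriction
   w of that element of U to H has, up to sign, sum 2 at y and 0 elsewhere, absolute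
   value at most 1 on edges between y and C, and 0 on edges with an end off C and y.
   Hence y has two neighbours common to all odd chordless cycles of B1. If y is on a
   chordless C, then C is exactly the support of w; and inserting y in a shortest odd
   cycle between two such neighbours gives an odd chordless cycle through y. Two odd
   chordless cycles C, C' avoiding y give relations on C + y and on C' + y whose
   difference lives on the union of C and C'; by independence of U it comes from
   relations on C or on C', of which there are none, and this forces C = C'. *)

Local Open Scope ring_scope.

Section ClassRepresentatives.
Variables (X : choiceType) (r : rel X).
Hypothesis r_equiv : equivalence_rel r.

Definition class_repr x : X := choose (r x) x.

Lemma class_reprP x : r x (class_repr x).
Proof. by apply: chooseP; case: (r_equiv x x x). Qed.

Lemma eq_class_repr x y : r x y -> class_repr x = class_repr y.
Proof.
move=> rxy; have eq_r : r x =1 r y by move=> z; have [_ ->] := r_equiv x y z.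
rewrite /class_repr (eq_choose eq_r); apply: choose_id; last by case: (r_equiv y y y).
by rewrite -eq_r; case: (r_equiv x x x).
Qed.

End ClassRepresentatives.

Lemma exists_linear_dependence (K : fieldType) (I J : finType) (f : I -> J -> K) :
  (#|J| < #|I|)%N ->
  exists2 c : I -> K, exists i, c i != 0 & forall j, \sum_i c i * f i j = 0.
Proof.
move=> ltJI; pose M : 'M[K]_(#|I|, #|J|) := \matrix_(i, j) f (enum_val i) (enum_val j).
have : kermx M != 0.
  rewrite kermx_eq0; apply: contraTN ltJI => /eqP rankM.
  by rewrite -leqNgt -rankM rank_leq_col.
case/rowV0Pn => w /sub_kermxP wM w0; exists (fun i => w 0 (enum_rank i)).
  by have [i wi] := rV0Pn _ w0; exists (enum_val i); rewrite enum_valK.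
move=> j; move/rowP: wM => /(_ (enum_rank j)); rewrite !mxE => wMj; rewrite -[RHS]wMj.
rewrite (reindex _ (onW_bij _ (enum_val_bij I))) /=.
by apply: eq_bigr => i _; rewrite mxE enum_valK enum_rankK.
Qed.

Lemma common_denominator (I : finType) (f : I -> rat) :
  exists2 N : rat, N != 0 & forall i, N * f i \is a Num.int.
Proof.
exists (\prod_i denq (f i))%:~R.
  by rewrite intr_eq0; apply/prodf_neq0 => i _; apply: denq_neq0.
move=> i; rewrite (bigD1 i) //= rmorphM /= mulrAC [_ * f i]mulrC -numqE -rmorphM /=.
exact: intr_int.
Qed.

Lemma expn_affine_ltn n c : exists t, ((t * c).+1 ^ n < t.+1 ^ n.+1)%N.
Proof.
exists (c.+1 ^ n)%N; set t := (c.+1 ^ n)%N; have t_gt0 : (0 < t)%N by rewrite expn_gt0.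
apply: (@leq_ltn_trans (t ^ n.+1)); last by rewrite ltn_exp2r.
apply: (@leq_trans ((t * c.+1) ^ n)); last by rewrite expnMn expnSr.
by case: (n) => // n'; rewrite leq_exp2r // mulnS -add1n leq_add2r.
Qed.

Lemma irreflexive_neq (X : eqType) (r : rel X) x y : irreflexive r -> r x y -> y != x.
Proof. by move=> r_irr; apply: contraTneq => ->; rewrite r_irr. Qed.

Lemma connect_uniq_path (T : finType) (r : rel T) x z : x != z -> connect r x z ->
  exists2 q, path r x (rcons q z) & uniq (x :: rcons q z).
Proof.
move=> xz /connectP[p0 xp0 zE]; case/shortenP: xp0 zE => p xp xp_uniq _ zE.
case/lastP: p xp xp_uniq zE => [_ _ /= zx|q z' xq xq_uniq]; first by rewrite zx eqxx in xz.
by rewrite last_rcons => ->; exists q.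
Qed.

(** * Edge weights and binomials *)

Section Edges.
Variables (T : finType) (e : rel T).
Implicit Types (E : {set T}) (x y v : T).

Lemma gedgeP E : reflect (exists x y, e x y /\ E = [set x; y]) (E \in gedges e).
Proof.
rewrite inE; apply: (iffP existsP) => [[x /existsP[y /andP[exy /eqP->]]]|[x [y [exy ->]]]].
  by exists x, y.
by exists x; apply/existsP; exists y; rewrite exy eqxx.
Qed.

Lemma set2_gedge x y : e x y -> [set x; y] \in gedges e.
Proof. by move=> exy; apply/gedgeP; exists x, y. Qed.

Lemma gedge_neighbour E v : symmetric e -> E \in gedges e -> v \in E ->
  exists2 w, e v w & E = [set v; w].
Proof.
move=> e_sym /gedgeP[x [y [exy ->]]]; rewrite !inE => /orP[] /eqP->; first by exists y.
by exists x; rewrite 1?e_sym // setUC.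
Qed.

Lemma card_gedge E : irreflexive e -> E \in gedges e -> #|E| = 2%N.
Proof.
move=> e_irr /gedgeP[x [y [exy ->]]].
by rewrite cards2; case: eqVneq exy => // ->; rewrite e_irr.
Qed.

Lemma set2_injr x : injective (fun y => [set x; y]).
Proof.
move=> y z E; have : y \in [set x; z] by rewrite -E set22.
have : z \in [set x; y] by rewrite E set22.
by rewrite !inE => /orP[] /eqP-> /orP[] /eqP.
Qed.

End Edges.

Notation weight T := {ffun {set T} -> rat^o}.

Section Weights.
Variables (T : finType) (e : rel T).
Implicit Types (E S H : {set T}) (v x z : T) (w a b : weight T) (c : rat).

Lemma weightZE c w E : (c *: w) E = c * w E.
Proof. by rewrite ffunE. Qed.

Definition vsum v w : rat := \sum_(E : {set T} | v \in E) w E.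

Lemma vsum_is_scalar v : scalar (vsum v).
Proof.
move=> c a b; rewrite /vsum mulr_sumr -big_split; apply: eq_bigr => E _.
by rewrite !ffunE.
Qed.
HB.instance Definition _ v :=
  GRing.isLinear.Build rat (weight T) rat *%R (vsum v) (vsum_is_scalar v).

Definition balanced w := forall v, vsum v w = 0.

Definition restrict H w : weight T := [ffun E : {set T} => if E \subset H then w E else 0].

Lemma restrict_is_linear H : linear (restrict H).
Proof.
move=> c a b; apply/ffunP => E; rewrite !ffunE.
by case: ifP => // _; rewrite scaler0 addr0.
Qed.
HB.instance Definition _ H :=
  GRing.isLinear.Build rat (weight T) (weight T) *:%R (restrict H) (restrict_is_linear H).

Definition indicator E : weight T := [ffun E' : {set T} => (E' == E)%:R].

Lemma vsum_indicator v E : vsum v (indicator E) = (v \in E)%:R.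
Proof.
rewrite /vsum; under eq_bigr do rewrite ffunE.
have [vE|vE] := boolP (v \in E).
  by rewrite (bigD1 E) //= eqxx big1 ?addr0 // => E' /andP[_ /negPf->].
by rewrite big1 // => E' vE'; case: eqVneq => // eqE; rewrite -eqE vE' in vE.
Qed.

Definition edge_supported S : {pred weight T} :=
  [pred w : weight T | [forall E, (w E != 0) ==> (E \in gedges e) && (E \subset S)]].

Lemma edge_supportedP S w :
  reflect (forall E, w E != 0 -> E \in gedges e /\ E \subset S) (w \in edge_supported S).
Proof.
apply: (iffP forallP) => [H E /(implyP (H E)) /andP[]//|H E].
by apply/implyP => /H[-> ->].
Qed.

Lemma edge_supported_submod_closed S : submod_closed (edge_supported S).
Proof.
split=> [|c a b /edge_supportedP aS /edge_supportedP bS]; apply/edge_supportedP => E.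
  by rewrite ffunE eqxx.
rewrite !ffunE; have [a0|/aS//] := eqVneq (a E) 0.
by rewrite a0 scaler0 add0r => /bS.
Qed.
HB.instance Definition _ S :=
  GRing.isSubmodClosed.Build rat (weight T) (edge_supported S)
    (edge_supported_submod_closed S).

Lemma edge_supportedS S S' w :
  S \subset S' -> w \in edge_supported S -> w \in edge_supported S'.
Proof.
move=> sub /edge_supportedP wS; apply/edge_supportedP => E /wS[-> ES].
by rewrite (subset_trans ES).
Qed.

Lemma edge_supportedI S S' w : w \in edge_supported S -> w \in edge_supported S' ->
  w \in edge_supported (S :&: S').
Proof.
move=> /edge_supportedP wS /edge_supportedP wS'; apply/edge_supportedP => E wE.
by have [[Ein ES] [_ ES']] := (wS _ wE, wS' _ wE); rewrite subsetI ES.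
Qed.

Lemma edge_supported_outside S w v E :
  w \in edge_supported S -> v \notin S -> v \in E -> w E = 0.
Proof.
move=> /edge_supportedP wS vS vE; apply/eqP; apply: contraNT vS => /wS[_ /subsetP].
exact.
Qed.

Lemma vsum_outside S w v : w \in edge_supported S -> v \notin S -> vsum v w = 0.
Proof.
by move=> wS vS; apply: big1 => E vE; apply: edge_supported_outside wS vS vE.
Qed.

Lemma indicator_supported S x z :
  x \in S -> z \in S -> e x z -> indicator [set x; z] \in edge_supported S.
Proof.
move=> xS zS exz; apply/edge_supportedP => E; rewrite ffunE pnatr_eq0 eqb0 negbK.
by move/eqP->; rewrite set2_gedge // subUset !sub1set xS zS.
Qed.

Lemma restrict_supported S H w :
  w \in edge_supported S -> restrict H w \in edge_supported H.
Proof.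
move=> /edge_supportedP wS; apply/edge_supportedP => E; rewrite ffunE.
by case: ifP => [sub /wS[]|_]; rewrite ?eqxx.
Qed.

Lemma restrict_id H w : w \in edge_supported H -> restrict H w = w.
Proof.
move=> /edge_supportedP wH; apply/ffunP => E; rewrite ffunE; case: ifP => // EH.
by apply/esym/eqP; apply: contraFT EH => /wH[].
Qed.

Lemma sum_vsum S w : irreflexive e -> w \in edge_supported S ->
  \sum_v vsum v w = 2%:R * \sum_E w E.
Proof.
move=> e_irr /edge_supportedP wS; rewrite /vsum (exchange_big_dep predT) //= mulr_sumr.
apply: eq_bigr => E _; rewrite sumr_const mulr_natl.
by have [->|/wS[/(card_gedge e_irr) -> //]] := eqVneq (w E) 0; rewrite !mul0rn.
Qed.

Definition multiset w : Prop :=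
  w \in edge_supported setT /\ forall E, w E \is a Num.nat.

Lemma multisetD a b : multiset a -> multiset b -> multiset (a + b).
Proof.
by move=> [aT an] [bT bn]; split=> [|E]; rewrite ?rpredD // ffunE rpredD.
Qed.

Lemma multiset_le_vsum w v E : multiset w -> v \in E -> w E <= vsum v w.
Proof.
move=> [_ wn] vE; rewrite /vsum (bigD1 E) //= lerDl.
by apply: sumr_ge0 => E' _; apply/natr_ge0.
Qed.

(* [(a, b)] stands for the binomial [x^a - x^b] of the toric ideal. *)
Definition toric_binomial (p : weight T * weight T) : Prop :=
  [/\ multiset p.1, multiset p.2 & forall v, vsum v p.1 = vsum v p.2].

Definition exponent_diff (p : weight T * weight T) : weight T := p.1 - p.2.

Definition markov_family k (u : 'I_k -> weight T * weight T) : Prop :=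
  [/\ forall i, toric_binomial (u i),
      forall c : 'I_k -> rat,
        \sum_i c i *: exponent_diff (u i) = 0 -> forall i, c i = 0
    & forall p, toric_binomial p -> exists2 c : 'I_k -> rat,
        exponent_diff p = \sum_i c i *: exponent_diff (u i)
        & forall i, c i != 0 -> forall v, vsum v (u i).1 <= vsum v p.1].

End Weights.

(** * Binomial generators of toric ideals *)

Module ToricAlgebra.
(* [Defs] is imported again because [mpoly] shadows the type it defines. *)
Import mpoly Defs.

Section Evaluation.
Variables (K : fieldType) (S : comNzRingType) (f : {rmorphism K -> S}).
Variable a : nat -> S.

Lemma meval_is_morphism n :
  zmod_morphism (meval K S f a n) /\ monoid_morphism (meval K S f a n).
Proof.
elim: n => [|n [IHa IHm]]; first by split; [exact: raddfB | exact: rmorphism_monoidP].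
pose additive_meval := GRing.isZmodMorphism.Build _ _ (meval K S f a n) IHa.
pose multiplicative_meval := GRing.isMonoidMorphism.Build _ _ (meval K S f a n) IHm.
pose g : {rmorphism mpoly K n -> S} :=
  HB.pack (meval K S f a n) additive_meval multiplicative_meval.
have mevalE (p : mpoly K n.+1) : meval K S f a n.+1 p = (map_poly g p).[a n] by [].
split=> [p q|]; first by rewrite !mevalE rmorphB hornerD hornerN.
by split=> [|p q]; rewrite !mevalE ?rmorph1 ?hornerC ?rmorphM ?hornerM.
Qed.

HB.instance Definition _ n :=
  GRing.isZmodMorphism.Build _ _ (meval K S f a n) (meval_is_morphism n).1.
HB.instance Definition _ n :=
  GRing.isMonoidMorphism.Build _ _ (meval K S f a n) (meval_is_morphism n).2.

Lemma mevalS n (p : mpoly K n.+1) :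
  meval K S f a n.+1 p = (map_poly (meval K S f a n) p).[a n].
Proof. by []. Qed.

Lemma meval_MXaddC n (p : {poly mpoly K n}) c :
  meval K S f a n.+1 (p * 'X + c%:P) =
  meval K S f a n.+1 p * a n + meval K S f a n c.
Proof.
by rewrite !mevalS rmorphD rmorphM /= map_polyX map_polyC hornerMXaddC.
Qed.

Lemma meval_mconst n c : meval K S f a n (mconst K n c) = f c.
Proof. by elim: n => //= n IH; rewrite map_polyC hornerC. Qed.

Lemma meval_mvar n i : (i < n)%N -> meval K S f a n (mvar K n i) = a i.
Proof.
elim: n => //= n IH; rewrite ltnS leq_eqVlt; case: eqVneq => [->|_ /= ltin].
  by rewrite map_polyX hornerX.
by rewrite map_polyC hornerC; exact: IH.
Qed.

End Evaluation.

Lemma eq_meval (K : fieldType) (S : comNzRingType) (f g : {rmorphism K -> S})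
    (a b : nat -> S) n :
  f =1 g -> (forall i, (i < n)%N -> a i = b i) ->
  meval K S f a n =1 meval K S g b n.
Proof.
move=> fg; elim: n => //= n IH ab p; rewrite ab //.
by congr (_.[_]); apply: eq_map_poly => q; apply: IH => i lin; apply/ab/ltnW.
Qed.

Lemma rmorph_meval (K : fieldType) (S S' : comNzRingType) (f : {rmorphism K -> S})
    (h : {rmorphism S -> S'}) a n p :
  h (meval K S f a n p) = meval K S' (h \o f) (h \o a) n p.
Proof.
elim: n p => //= n IH p.
by rewrite -horner_map -map_poly_comp /=; congr (_.[_]); apply: eq_map_poly.
Qed.

Lemma mconst_is_morphism (K : fieldType) n :
  zmod_morphism (mconst K n) /\ monoid_morphism (mconst K n).
Proof.
elim: n => [|n [IHa [IH1 IHm]]]; first by split.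
split=> [p q|]; first by rewrite /= IHa polyCB.
by split=> [|p q]; rewrite /= ?IH1 ?IHm ?polyCM.
Qed.
HB.instance Definition _ K n :=
  GRing.isZmodMorphism.Build _ _ (mconst K n) (mconst_is_morphism K n).1.
HB.instance Definition _ K n :=
  GRing.isMonoidMorphism.Build _ _ (mconst K n) (mconst_is_morphism K n).2.

Lemma meval_id (K : fieldType) n :
  meval K _ (mconst K n) (mvar K n) n =1 id.
Proof.
elim: n => // n IH p; rewrite mevalS.
rewrite (_ : mvar K n.+1 n = 'X); last by rewrite /= eqxx.
have -> : map_poly (meval K (mpoly K n.+1) (mconst K n.+1) (mvar K n.+1) n) p
   = map_poly (polyC \o id) p.
  apply: eq_map_poly => q /=; rewrite -{2}[q]IH.
  rewrite (rmorph_meval _ (polyC : {rmorphism mpoly K n -> {poly mpoly K n}})).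
  apply: (eq_meval (f := mconst K n.+1) (g := polyC \o mconst K n)) => // i lin /=.
  by rewrite ltn_eqF.
by rewrite map_poly_comp map_poly_id // -[RHS]comp_polyXr.
Qed.

Definition extend_ord (n : nat) (S : nmodType) (a : 'I_n -> S) (i : nat) : S :=
  if insub i is Some j then a j else 0.

Lemma extend_ordE n (S : nmodType) (a : 'I_n -> S) (i : 'I_n) : extend_ord a i = a i.
Proof. by rewrite /extend_ord valK. Qed.

Section MpolyIso.
Variables (K : fieldType) (n : nat).

Definition to_mpoly : mpoly K n -> {mpoly K[n]} :=
  meval K _ (mpolyC n (R := K)) (extend_ord (fun i : 'I_n => 'X_i)) n.

Definition of_mpoly : {mpoly K[n]} -> mpoly K n :=
  mmap (mconst K n) (fun i : 'I_n => mvar K n i).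

HB.instance Definition _ := GRing.RMorphism.on to_mpoly.
HB.instance Definition _ := GRing.RMorphism.on of_mpoly.

Lemma to_mpoly_mconst c : to_mpoly (mconst K n c) = c%:MP.
Proof. exact: meval_mconst. Qed.

Lemma to_mpoly_mvar (i : 'I_n) : to_mpoly (mvar K n i) = 'X_i.
Proof. by rewrite /to_mpoly meval_mvar // extend_ordE. Qed.

Lemma mmap_to_mpoly (S : comNzRingType) (f : {rmorphism K -> S}) (a : 'I_n -> S) p :
  mmap f a (to_mpoly p) = meval K S f (extend_ord a) n p.
Proof.
rewrite (rmorph_meval _ (mmap f a)); apply: eq_meval => [c|i lin] /=.
  exact: mmapC.
by rewrite -[i]/(val (Ordinal lin)) !extend_ordE mmapX mmap1U.
Qed.

Lemma to_mpolyK : cancel to_mpoly of_mpoly.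
Proof.
move=> p; rewrite /of_mpoly mmap_to_mpoly -[RHS]meval_id; apply: eq_meval => // i lin.
by rewrite -[i]/(val (Ordinal lin)) extend_ordE.
Qed.

Lemma of_mpolyK : cancel of_mpoly to_mpoly.
Proof.
move=> p; rewrite [p in RHS]mpolyE /of_mpoly /mmap rmorph_sum; apply: eq_bigr => a _.
rewrite rmorphM /= to_mpoly_mconst mul_mpolyC; congr (_ *: _).
rewrite mpolyXE_id rmorph_prod; apply: eq_bigr => i _.
by rewrite rmorphXn /= to_mpoly_mvar.
Qed.

End MpolyIso.

Lemma to_mpoly_meval (K : fieldType) m N (a : nat -> mpoly K m) (F : mpoly K N) :
  to_mpoly (meval K _ (mconst K m) a N F) =
  mmap (mpolyC m (R := K)) (fun i : 'I_N => to_mpoly (a i)) (to_mpoly F).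
Proof.
rewrite rmorph_meval mmap_to_mpoly.
apply: (eq_meval (f := @to_mpoly K m \o mconst K m) (g := mpolyC m (R := K))) => [c|i lin].
  exact: to_mpoly_mconst.
by rewrite -[i]/(val (Ordinal lin)) extend_ordE.
Qed.

Lemma mcoeff_sum_mpolyX (R : nzRingType) n (I : eqType) (r : seq I) (c : I -> R)
    (g : I -> 'X_{1..n}) i :
  injective g -> uniq r -> i \in r -> (\sum_(j <- r) c j *: 'X_[g j])@_(g i) = c i.
Proof.
move=> g_inj r_uniq ir; rewrite raddf_sum (bigD1_seq i) //= mcoeffZ mcoeffX eqxx mulr1.
rewrite big1 ?addr0 // => j ji; rewrite mcoeffZ mcoeffX.
by rewrite (inj_eq g_inj) (negPf ji) mulr0.
Qed.

Lemma msizeM_leq (R : idomainType) m (p q : {mpoly R[m]}) i j :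
  (msize p <= i.+1)%N -> (msize q <= j.+1)%N -> (msize (p * q) <= (i + j).+1)%N.
Proof.
move=> p_le q_le; have [->|p0] := eqVneq p 0; first by rewrite mul0r msize0.
have [->|q0] := eqVneq q 0; first by rewrite mulr0 msize0.
by rewrite msizeM // -subn1 leq_subLR add1n -addnS -addSn leq_add.
Qed.

Lemma msize_mmap1_leq (R : idomainType) m n (a : 'I_n -> {mpoly R[m]}) d s :
  (forall i, msize (a i) <= d.+1)%N -> (msize (mmap1 a s) <= (mdeg s * d).+1)%N.
Proof.
move=> a_le; rewrite /mmap1 mdegE.
have msize_expr_leq i k : (msize (a i ^+ k) <= (k * d).+1)%N.
  elim: k => [|k IH]; first by rewrite msize1.
  by rewrite exprS mulSn msizeM_leq.
elim/big_rec2: _ => [|i p k _ IH]; first by rewrite msize1.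
by rewrite mulnDl msizeM_leq.
Qed.

(* There are too many monomials of bounded exponents in [m.+1] variables for their
   images under the [a i] to be linearly independent: those have bounded degree
   in only [m] variables. *)
Lemma mpoly_alg_dependent (K : fieldType) m (a : 'I_m.+1 -> {mpoly K[m]}) :
  exists2 F : {mpoly K[m.+1]}, F != 0 & mmap (mpolyC m (R := K)) a F = 0.
Proof.
pose d := (\max_i msize (a i))%N; have [t lt_t] := expn_affine_ltn m (m.+1 * d).
pose k := (t * (m.+1 * d)).+1%N; pose I := {ffun 'I_m.+1 -> 'I_t.+1}.
pose mnm n l (s : {ffun 'I_n -> 'I_l}) : 'X_{1..n} := [multinom (s i : nat) | i < n].
have mnm_inj n l : injective (@mnm n l).
  by move=> s s' /mnmP eq_s; apply/ffunP => i; apply/val_inj; have := eq_s i; rewrite !mnmE.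
have [|c [s0 c_s0] c_dep] := exists_linear_dependence
    (fun (s : I) (q : {ffun 'I_m -> 'I_k}) => (mmap1 a (mnm _ _ s))@_(mnm _ _ q)).
  by rewrite !card_ffun !card_ord.
exists (\sum_s c s *: 'X_[mnm _ _ s]).
  apply: contraNneq c_s0 => F0.
  rewrite -(mcoeff_sum_mpolyX c (@mnm_inj _ _) (r := index_enum I)).
  - by rewrite F0 mcoeff0.
  - exact: index_enum_uniq.
  - exact: mem_index_enum.
apply/mpolyP => q; rewrite mcoeff0 [mmap _ _ _]raddf_sum raddf_sum /=.
have [/forallP q_lt|/forallPn[i q_ge]] := boolP [forall i, q i < k]%N.
  have -> : q = mnm _ _ [ffun i => Ordinal (q_lt i)] by apply/mnmP => i; rewrite mnmE ffunE.
  apply: etrans (c_dep [ffun i => Ordinal (q_lt i)]); apply: eq_bigr => s _.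
  by rewrite mmapZ mmapX mul_mpolyC mcoeffZ.
apply: big1 => s _; rewrite mmapZ mmapX mul_mpolyC mcoeffZ.
rewrite (memN_msupp_eq0 (m := q)) ?mulr0 //; apply: msize_mdeg_ge.
have a_le j : (msize (a j) <= d.+1)%N by apply/leqW/leq_bigmax.
apply: leq_trans (msize_mmap1_leq _ a_le) _; apply: (@leq_trans k).
  rewrite ltnS mulnCA mulnA leq_mul2r; apply/orP; right.
  rewrite mdegE -[X in (_ <= X * _)%N]card_ord -sum_nat_const; apply: leq_sum => j _.
  by rewrite mnmE -ltnS.
move: q_ge; rewrite -leqNgt => /leq_trans; apply.
by rewrite mdegE (bigD1 i) //= leq_addr.
Qed.

Section AlgebraicIndependence.
Variables (K : fieldType) (m : nat).
Implicit Types (P Q : mpoly K m -> Prop) (a : nat -> mpoly K m).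

Definition alg_indep_mod P N a :=
  forall F : mpoly K N, P (meval K _ (mconst K m) a N F) -> F = 0.

Lemma alg_indep_mod_leq P N N' a :
  (N' <= N)%N -> alg_indep_mod P N a -> alg_indep_mod P N' a.
Proof.
elim: N => [|N IH]; first by rewrite leqn0 => /eqP->.
rewrite leq_eqVlt => /predU1P[-> //|lt] indep; apply: IH => // F PF.
by apply: polyC_inj; apply: indep; rewrite mevalS map_polyC hornerC.
Qed.

Lemma alg_indep_mod_size P N a : P 0 -> alg_indep_mod P N a -> (N <= m)%N.
Proof.
move=> P0 indep; rewrite leqNgt; apply/negP => lt_mN.
have {}indep := alg_indep_mod_leq lt_mN indep.
have [F F0 F_a] := mpoly_alg_dependent (fun i : 'I_m.+1 => to_mpoly (a i)).
case/eqP: F0; rewrite -[F]of_mpolyK (indep (of_mpoly F)) ?raddf0 //.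
rewrite -[meval _ _ _ _ _ _]to_mpolyK to_mpoly_meval of_mpolyK F_a raddf0.
exact: P0.
Qed.

Lemma alg_indep_mod_extend P Q N a x :
  is_prime_ideal P -> is_ideal Q -> ideal_sub P Q -> Q x -> ~ P x ->
  alg_indep_mod Q N a ->
  alg_indep_mod P N.+1 (fun i => if i == N then x else a i).
Proof.
move=> [_ _ P_prime] [_ QD QM] PQ Qx nPx indep F.
set b := fun i => _; have bN : b N = x by rewrite /b eqxx.
have meval_b q : meval K _ (mconst K m) b N q = meval K _ (mconst K m) a N q.
  by apply: eq_meval => // i lin; rewrite /b ltn_eqF.
elim/poly_ind: F => [//|F c IH]; rewrite meval_MXaddC bN => PFc.
have c0 : c = 0.
  apply: indep; rewrite -meval_b /=.
  rewrite -[X in Q X](addKr (meval K _ (mconst K m) b N.+1 F * x)) -mulNr.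
  by apply: (QD) (PQ _ PFc); apply: (QM).
move: PFc; rewrite c0 !raddf0 !addr0 => /P_prime[/IH->|//]; exact: mul0r.
Qed.

Lemma prime_chain_leq P h d a :
  prime_chain_to P h -> alg_indep_mod P d a -> (d + h <= m)%N.
Proof.
case=> Q [Q_prime Q_ssub QP] indep.
suff /(_ h (leqnn h))[b] : forall j, (j <= h)%N ->
    exists b, alg_indep_mod (Q (h - j)%N) (d + j) b.
  by apply: alg_indep_mod_size; rewrite subnn; case: (Q_prime 0 (leq0n _)) => -[].
elim=> [_|j IH lt_jh]; first by exists a; rewrite subn0 addn0 => F /QP; apply: indep.
have [b indep_b] := IH (ltnW lt_jh).
have hjE : (h - j)%N = (h - j.+1).+1 by lia.
have lt_hj : (h - j.+1 < h)%N by lia.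
have [sub [x [Qx nQx]]] := Q_ssub _ lt_hj.
rewrite addnS; exists (fun i => if i == (d + j)%N then x else b i).
apply: alg_indep_mod_extend sub _ nQx _; rewrite -?hjE //.
- by apply: Q_prime; apply: leq_subr.
- by case: (Q_prime (h - j)%N (leq_subr _ _)).
- by rewrite hjE.
Qed.

Lemma ideal_height_leq P h d a :
  is_prime_ideal P -> ideal_height P h -> alg_indep_mod P d a -> (d + h <= m)%N.
Proof.
move=> P_prime [_ h_min] indep.
have [k Pk] : exists k, prime_height P k.
  apply: contrapT => no.
  suff /(_ m.+1) : forall j, prime_chain_to P j.
    by move=> /prime_chain_leq /(_ indep); lia.
  elim=> [|j IH]; first by exists (fun=> P); split.
  by apply: contrapT => nj; apply: no; exists j.
have lt_hk : (h <= k)%N by apply: h_min Pk.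
by have := prime_chain_leq Pk.1 indep; lia.
Qed.

End AlgebraicIndependence.

Section ToricMap.
Variables (K : fieldType) (m n : nat) (D : 'I_m -> 'X_{1..n}).
Implicit Types a b c x : 'X_{1..m}.

Definition tdeg a : 'X_{1..n} := (\sum_i D i *+ a i)%MM.

Lemma tdegE a v : tdeg a v = (\sum_i D i v * a i)%N.
Proof. by rewrite mnm_sumE; apply: eq_bigr => i _; rewrite mulmnE. Qed.

Lemma tdegD a b : tdeg (a + b)%MM = (tdeg a + tdeg b)%MM.
Proof.
apply/mnmP => v; rewrite mnmDE !tdegE -big_split; apply: eq_bigr => i _.
by rewrite mnmDE mulnDr.
Qed.

Lemma tdeg1 i : tdeg U_(i)%MM = D i.
Proof.
apply/mnmP => v; rewrite tdegE (bigD1 i) //= mnm1E eqxx muln1 big1 ?addn0 // => j ji.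
by rewrite mnm1E eq_sym (negPf ji) muln0.
Qed.

Definition toric_mmap : {mpoly K[m]} -> {mpoly K[n]} :=
  mmap (mpolyC n (R := K)) (fun i => 'X_[D i]).

HB.instance Definition _ := GRing.RMorphism.on toric_mmap.

Lemma toric_mmapX a : toric_mmap 'X_[a] = 'X_[tdeg a].
Proof. by rewrite /toric_mmap mmapX /mmap1 mprodXnE. Qed.

Lemma toric_mmapE q : toric_mmap q = \sum_(a <- msupp q) q@_a *: 'X_[tdeg a].
Proof.
rewrite {1}[q]mpolyE raddf_sum; apply: eq_bigr => a _.
by rewrite /= [toric_mmap _]mmapZ [mmap _ _ _]toric_mmapX mul_mpolyC.
Qed.

Lemma toric_mmap_inj q : injective tdeg -> toric_mmap q = 0 -> q = 0.
Proof.
move=> tdeg_inj q0; apply/mpolyP => a; rewrite mcoeff0.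
have [aq|] := boolP (a \in msupp q); last exact: memN_msupp_eq0.
have := mcoeff_sum_mpolyX (fun b => q@_b) tdeg_inj (msupp_uniq q) aq.
by rewrite -toric_mmapE q0 mcoeff0.
Qed.

Lemma same_tdeg_equiv : equivalence_rel (fun a b => tdeg a == tdeg b).
Proof. by move=> a b c; split=> // /eqP->. Qed.

Definition fiber_repr : 'X_{1..m} -> 'X_{1..m} :=
  class_repr (fun a b => tdeg a == tdeg b).

Lemma tdeg_fiber_repr a : tdeg (fiber_repr a) = tdeg a.
Proof. by apply/esym/eqP/(class_reprP same_tdeg_equiv). Qed.

Lemma eq_fiber_repr a b : tdeg a = tdeg b -> fiber_repr a = fiber_repr b.
Proof. by move=> ab; apply: (eq_class_repr same_tdeg_equiv); apply/eqP. Qed.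

Lemma toric_mmap_eq0_binomials q : toric_mmap q = 0 ->
  q = \sum_(a <- msupp q) q@_a *: ('X_[a] - 'X_[fiber_repr a]).
Proof.
move=> q0; under eq_bigr do rewrite scalerBr.
rewrite sumrB -mpolyE; set r := \sum_(a <- _) _.
suff -> : r = 0 by rewrite subr0.
apply/mpolyP => c; rewrite mcoeff0 raddf_sum /=.
have [c_repr|c_repr] := eqVneq c (fiber_repr c).
  transitivity ((toric_mmap q)@_(tdeg c)); last by rewrite q0 mcoeff0.
  rewrite toric_mmapE raddf_sum; apply: eq_bigr => a _ /=; rewrite !mcoeffZ !mcoeffX.
  congr (_ * _%:R); congr (nat_of_bool _); apply/eqP/eqP => [<-|/eq_fiber_repr->//].
  by rewrite tdeg_fiber_repr.
rewrite big1 // => a _; rewrite mcoeffZ mcoeffX.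
case: eqVneq => [ac|]; last by rewrite mulr0.
by case/eqP: c_repr; rewrite -ac; apply: eq_fiber_repr; rewrite tdeg_fiber_repr.
Qed.

(* [linked a b] holds iff the binomial [x^a - x^b] of the kernel [I] lies in [m I],
   where [m] is the ideal of the variables. *)
Inductive linked : 'X_{1..m} -> 'X_{1..m} -> Prop :=
| linked_refl a : linked a a
| linked_step a b c i : tdeg a = tdeg b -> (0 < a i)%N -> (0 < b i)%N ->
    linked b c -> linked a c.

Lemma linked_tdeg a b : linked a b -> tdeg a = tdeg b.
Proof. by elim=> // a' b' c i ->. Qed.

Lemma linked_trans b a c : linked a b -> linked b c -> linked a c.
Proof. by elim=> // a' b' c' i ab' ai bi _ IH /IH; apply: linked_step ai bi. Qed.

Lemma linked_sym a b : linked a b -> linked b a.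
Proof.
elim=> [c|a' b' c i ab' ai bi _ IH]; first exact: linked_refl.
by apply: linked_trans IH _; apply: linked_step bi ai (linked_refl _).
Qed.

Lemma linked_add d a b : d != 0%MM -> tdeg a = tdeg b -> linked (d + a)%MM (d + b)%MM.
Proof.
move=> d0 ab; have [i di] : exists i, (0 < d i)%N.
  apply: contrapT => no; case/eqP: d0; apply/mnmP => i; rewrite mnm0E.
  by apply/eqP; rewrite -leqn0 leqNgt; apply/negP => di; apply: no; exists i.
apply: (@linked_step _ _ _ i _ _ _ (linked_refl _)).
- by rewrite !tdegD ab.
- by rewrite mnmDE addn_gt0 di.
- by rewrite mnmDE addn_gt0 di.
Qed.

Lemma linked_equiv : equivalence_rel (fun a b => `[< linked a b >]).
Proof.
move=> a b c; split=> [|/asboolP ab]; first by apply/asboolP/linked_refl.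
by apply: asbool_equiv_eq; split; apply: linked_trans => //; apply: linked_sym.
Qed.

Definition linked_repr : 'X_{1..m} -> 'X_{1..m} :=
  class_repr (fun a b => `[< linked a b >]).

Lemma linked_reprP a : linked a (linked_repr a).
Proof. exact/asboolP/(class_reprP linked_equiv). Qed.

Lemma eq_linked_repr a b : linked a b -> linked_repr a = linked_repr b.
Proof. by move=> ab; apply: (eq_class_repr linked_equiv); apply/asboolP. Qed.

Lemma tdeg_linked_repr a : tdeg (linked_repr a) = tdeg a.
Proof. by rewrite -(linked_tdeg (linked_reprP a)). Qed.

Lemma linked_repr_id a : linked_repr (linked_repr a) = linked_repr a.
Proof. exact/esym/eq_linked_repr/linked_reprP. Qed.

Definition fiber_base a : 'X_{1..m} := linked_repr (fiber_repr a).

Lemma tdeg_fiber_base a : tdeg (fiber_base a) = tdeg a.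
Proof. by rewrite tdeg_linked_repr tdeg_fiber_repr. Qed.

Lemma eq_fiber_base a b : tdeg a = tdeg b -> fiber_base a = fiber_base b.
Proof. by move=> ab; rewrite /fiber_base (eq_fiber_repr ab). Qed.

(* The binomials [x^a - x^(fiber_base a)] with [a] a minimal lead form a basis of
   [I / m I]. *)
Definition minimal_lead a := linked_repr a = a /\ fiber_base a <> a.

Lemma minimal_lead_not_linked a x :
  minimal_lead a -> tdeg a = tdeg x -> ~ linked a (fiber_base x).
Proof.
move=> [a_repr a_base] ax link; apply: a_base.
by rewrite (eq_fiber_base ax) -[RHS]a_repr (eq_linked_repr link) linked_repr_id.
Qed.

Section LinkedClassSum.
Hypothesis tdeg_mdeg : forall a b, tdeg a = tdeg b -> mdeg a = mdeg b.

Definition linked_sum x (p : {mpoly K[m]}) : K :=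
  \sum_(a : 'X_{1..m < (mdeg x).+1} | `[< linked x a >]) p@_a.

Lemma linked_sum_is_scalar x : scalar (linked_sum x).
Proof.
move=> k p q; rewrite /linked_sum mulr_sumr -big_split; apply: eq_bigr => a _.
by rewrite mcoeffD mcoeffZ.
Qed.
HB.instance Definition _ x :=
  GRing.isLinear.Build K {mpoly K[m]} K *%R (linked_sum x) (linked_sum_is_scalar x).

Lemma linked_sumX x c : linked_sum x 'X_[c] = `[< linked x c >]%:R.
Proof.
rewrite /linked_sum; case: asboolP => xc; last first.
  rewrite big1 // => a /asboolP xa; rewrite mcoeffX.
  by case: eqVneq => // ca; case: xc; rewrite ca.
have c_lt : (mdeg c < (mdeg x).+1)%N by rewrite (tdeg_mdeg (linked_tdeg xc)).
rewrite (bigD1 (BMultinom c_lt)) /=; last exact/asboolP.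
rewrite mcoeffX eqxx big1 ?addr0 // => a /andP[_ ac]; rewrite mcoeffX.
by case: eqVneq => // ca; case/eqP: ac; apply: val_inj; rewrite /= ca.
Qed.

Lemma linked_sum_binomial x a b : linked a b -> linked_sum x ('X_[a] - 'X_[b]) = 0.
Proof.
move=> ab; rewrite raddfB /= !linked_sumX.
suff -> : `[< linked x a >] = `[< linked x b >] by rewrite subrr.
apply: asbool_equiv_eq; split=> /linked_trans; apply=> //.
exact: linked_sym.
Qed.

(* [linked_sum x] kills [m I], so it only sees the constant term of [p]. *)
Lemma linked_sumM x p q :
  toric_mmap q = 0 -> linked_sum x (p * q) = p@_0%MM * linked_sum x q.
Proof.
move=> q0.
have sumXM d : linked_sum x ('X_[d] * q) = (d == 0%MM)%:R * linked_sum x q.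
  have [->|d0] := eqVneq d 0%MM; first by rewrite mpolyX0 !mul1r.
  rewrite mul0r {1}(toric_mmap_eq0_binomials q0) mulr_sumr raddf_sum big1 // => a _ /=.
  rewrite -scalerAr linearZ /= mulrBr -!mpolyXD linked_sum_binomial ?mulr0 //.
  by apply: linked_add => //; rewrite tdeg_fiber_repr.
rewrite {1}[p]mpolyE mulr_suml raddf_sum /=.
under eq_bigr do rewrite -scalerAl linearZ /= sumXM mulrA.
rewrite -mulr_suml; congr (_ * _).
have [p0|p0] := boolP (0%MM \in msupp p).
  rewrite (bigD1_seq 0%MM) ?msupp_uniq //= eqxx mulr1 big1 ?addr0 //.
  by move=> d /negPf ->; rewrite mulr0.
rewrite (memN_msupp_eq0 p0) big_seq big1 // => d dp.
by case: eqVneq dp p0 => [-> ->//|_]; rewrite mulr0.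
Qed.

Section GeneratorCount.
Variables (h : nat) (g : 'I_h -> {mpoly K[m]}).
Hypothesis g_ker : forall k, toric_mmap (g k) = 0.
Hypothesis g_gen : forall q, toric_mmap q = 0 ->
  exists c : 'I_h -> {mpoly K[m]}, q = \sum_k c k * g k.

Lemma size_minimal_leads s :
  uniq s -> (forall x, x \in s -> minimal_lead x) -> (size s <= h)%N.
Proof.
move=> s_uniq s_lead; pose x i := nth 0%MM s i.
have x_lead (i : 'I_(size s)) : minimal_lead (x i) by apply/s_lead/mem_nth.
have /choice[c cE] : forall j : 'I_(size s), exists c : 'I_h -> {mpoly K[m]},
    'X_[x j] - 'X_[fiber_base (x j)] = \sum_k c k * g k.
  by move=> j; apply: g_gen; rewrite raddfB /= !toric_mmapX tdeg_fiber_base subrr.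
pose C : 'M[K]_(size s, h) := \matrix_(j, k) (c j k)@_0%MM.
pose G : 'M[K]_(h, size s) := \matrix_(k, i) linked_sum (x i) (g k).
suff CG : C *m G = 1%:M.
  apply: leq_trans (rank_leq_col C).
  by have := mxrankM_maxl C G; rewrite CG mxrank1.
apply/matrixP => j i; rewrite !mxE.
transitivity (linked_sum (x i) ('X_[x j] - 'X_[fiber_base (x j)])).
  by rewrite cE raddf_sum; apply: eq_bigr => k _ /=; rewrite !mxE linked_sumM.
have base_unlinked : ~ linked (x i) (fiber_base (x j)).
  move=> link; have := linked_tdeg link; rewrite tdeg_fiber_base => ij.
  exact: minimal_lead_not_linked (x_lead i) ij link.
rewrite raddfB /= !linked_sumX (asboolF base_unlinked) subr0.
congr _%:R; congr (nat_of_bool _); apply/asboolP/eqP => [link|->]; last exact: linked_refl.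
have [[xi_repr _] [xj_repr _]] := (x_lead i, x_lead j).
apply/esym/val_inj/eqP; rewrite -(nth_uniq 0%MM (ltn_ord i) (ltn_ord j) s_uniq); apply/eqP.
by rewrite -/(x i) -/(x j) -xi_repr -xj_repr (eq_linked_repr link).
Qed.

Lemma enum_minimal_leads :
  exists s, [/\ uniq s, (size s <= h)%N & forall x, x \in s <-> minimal_lead x].
Proof.
suff /cardinality.finite_seqP[s sE] : cardinality.finite_set minimal_lead.
  have mem_s x : x \in undup s <-> minimal_lead x by rewrite mem_undup sE.
  exists (undup s); split=> //; first exact: undup_uniq.
  apply: size_minimal_leads => [|x /mem_s//]; exact: undup_uniq.
apply: contrapT => /(cardinality.infinite_set_fset h.+1)[B sub_B]; apply/negP.
by rewrite -leqNgt; apply: size_minimal_leads => [|x /sub_B//]; apply: finmap.fset_uniq.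
Qed.

End GeneratorCount.
End LinkedClassSum.
End ToricMap.

Section MonomialDifferences.
Variables (m n : nat) (D : 'I_m -> 'X_{1..n}).
Implicit Types a b c x : 'X_{1..m}.

Definition mnm_row k (a : 'X_{1..k}) : 'rV[rat]_k := \row_i (a i)%:R.

Lemma mnm_rowD k (a b : 'X_{1..k}) : mnm_row (a + b)%MM = mnm_row a + mnm_row b.
Proof. by apply/rowP => i; rewrite !mxE mnmDE natrD. Qed.

Lemma mnm_row_inj k : injective (@mnm_row k).
Proof.
move=> a b /rowP eq_ab; apply/mnmP => i; have /eqP := eq_ab i.
by rewrite !mxE eqr_nat => /eqP.
Qed.

Definition tdeg_mx : 'M[rat]_(m, n) := \matrix_i mnm_row (D i).

Lemma mnm_row_tdeg a : mnm_row a *m tdeg_mx = mnm_row (tdeg D a).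
Proof.
apply/rowP => j; rewrite !mxE tdegE natr_sum; apply: eq_bigr => i _.
by rewrite !mxE natrM mulrC.
Qed.

Hypothesis tdeg_mdeg : forall a b, tdeg D a = tdeg D b -> mdeg a = mdeg b.
Variables (k : nat) (u : 'I_k -> 'X_{1..m}).
Hypothesis u_lead : forall x, minimal_lead D x -> exists i, u i = x.

Definition lead_row i : 'rV[rat]_m := mnm_row (u i) - mnm_row (fiber_base D (u i)).

Definition span_below (b : 'X_{1..n}) (v : 'rV[rat]_m) :=
  exists2 c : 'I_k -> rat, v = \sum_i c i *: lead_row i
    & forall i, c i != 0 -> (tdeg D (u i) <= b)%MM.

Lemma span_belowB (b : 'X_{1..n}) v w :
  span_below b v -> span_below b w -> span_below b (v - w).
Proof.
move=> [c -> cb] [d -> db]; exists (fun i => c i - d i).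
  by rewrite -sumrB; apply: eq_bigr => i _; rewrite scalerBl.
move=> i; have [ci|/cb//] := eqVneq (c i) 0.
by rewrite ci sub0r oppr_eq0 => /db.
Qed.

Lemma span_below0 (b : 'X_{1..n}) : span_below b 0.
Proof.
exists (fun=> 0); first by rewrite big1 // => i _; rewrite scale0r.
by move=> i; rewrite eqxx.
Qed.

Lemma span_belowD (b : 'X_{1..n}) v w :
  span_below b v -> span_below b w -> span_below b (v + w).
Proof.
move=> bv bw; rewrite -[w]opprK -[- w]sub0r; apply: span_belowB => //.
by apply: span_belowB => //; apply: span_below0.
Qed.

Lemma span_below_lead i : span_below (tdeg D (u i)) (lead_row i).
Proof.
exists (fun j => (j == i)%:R).
  by rewrite (bigD1 i) //= eqxx scale1r big1 ?addr0 // => j /negPf->; rewrite scale0r.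
by move=> j; case: (eqVneq j i) => [-> _|_]; rewrite ?eqxx //; apply: lepm_refl.
Qed.

Lemma span_below_leq (b b' : 'X_{1..n}) v :
  (b <= b')%MM -> span_below b v -> span_below b' v.
Proof. by move=> le [c -> cb]; exists c => // i /cb /lepm_trans; apply. Qed.

Lemma span_below_linked_repr a :
  span_below (tdeg D a) (mnm_row (linked_repr D a) - mnm_row (fiber_base D a)).
Proof.
have [->|/eqP not_base] := eqVneq (fiber_base D a) (linked_repr D a).
  by rewrite subrr; apply: span_below0.
have base_repr : fiber_base D (linked_repr D a) = fiber_base D a.
  by apply: eq_fiber_base; rewrite tdeg_linked_repr.
have [|i ui] := @u_lead (linked_repr D a).
  by split; rewrite ?linked_repr_id ?base_repr.
by have := span_below_lead i; rewrite /lead_row ui base_repr tdeg_linked_repr.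
Qed.

Lemma span_below_common_variable a b i :
  (forall a' b', (mdeg a' < mdeg a)%N -> tdeg D a' = tdeg D b' ->
     span_below (tdeg D a') (mnm_row a' - mnm_row b')) ->
  tdeg D a = tdeg D b -> (0 < a i)%N -> (0 < b i)%N ->
  span_below (tdeg D a) (mnm_row a - mnm_row b).
Proof.
move=> IH ab ai bi.
have Ua : (U_(i) <= a)%MM by rewrite lep1mP -lt0n.
have Ub : (U_(i) <= b)%MM by rewrite lep1mP -lt0n.
have ab' : tdeg D (a - U_(i))%MM = tdeg D (b - U_(i))%MM.
  by apply: (@addIm _ (tdeg D U_(i))); rewrite -!tdegD !submK.
rewrite -{2}(submK Ua) -(submK Ub) !mnm_rowD opprD addrACA subrr addr0.
apply: span_below_leq (IH _ _ _ ab'); first by rewrite -{2}(submK Ua) tdegD lem_addr.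
by rewrite -{2}(submK Ua) mdegD mdeg1 addn1.
Qed.

Lemma span_below_tdeg a b :
  tdeg D a = tdeg D b -> span_below (tdeg D a) (mnm_row a - mnm_row b).
Proof.
have [d] := ubnP (mdeg a); elim: d => // d IH in a b * => le_ad ab.
have span_repr c : tdeg D a = tdeg D c ->
    span_below (tdeg D a) (mnm_row c - mnm_row (linked_repr D c)).
  move=> ac; rewrite ac; have le_cd : (mdeg c <= d)%N by rewrite -(tdeg_mdeg ac).
  elim: (linked_reprP D c) le_cd => [x _|x y z i xy xi yi _ IHz le_xd].
    by rewrite subrr; apply: span_below0.
  rewrite -(subrKA (mnm_row y)); apply: span_belowD; last first.
    by rewrite xy; apply: IHz; rewrite -(tdeg_mdeg xy).
  apply: span_below_common_variable xy xi yi => x' y' lt_x'; apply: IH.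
  exact: leq_trans le_xd.
rewrite -(subrKA (mnm_row (fiber_base D a))); apply: span_belowD.
  rewrite -(subrKA (mnm_row (linked_repr D a))).
  by apply: span_belowD; [apply: span_repr|apply: span_below_linked_repr].
rewrite -opprB -sub0r; apply: span_belowB; first exact: span_below0.
rewrite -(subrKA (mnm_row (linked_repr D b))) (eq_fiber_base ab).
by apply: span_belowD; [apply: span_repr|rewrite ab; apply: span_below_linked_repr].
Qed.

Lemma kermx_tdeg_difference v : v *m tdeg_mx = 0 ->
  exists2 N : rat, N != 0 & exists a b,
    tdeg D a = tdeg D b /\ N *: v = mnm_row a - mnm_row b.
Proof.
move=> vD; have [N N0 Nv] := common_denominator (v 0); exists N => //.
pose x i := N * v 0 i.
have abs_nat i : `|x i| \is a Num.nat by rewrite natr_norm_int ?Nv.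
have shift_nat i : x i + `|x i| \is a Num.nat.
  rewrite natrEint rpredD ?Nv ?intr_nat //=.
  by rewrite -[x in x + _]opprK addrC subr_ge0 -normrN ler_norm.
pose a : 'X_{1..m} := [multinom Num.truncn (x i + `|x i|) | i < m].
pose b : 'X_{1..m} := [multinom Num.truncn `|x i| | i < m].
have NvE : N *: v = mnm_row a - mnm_row b.
  by apply/rowP => i; rewrite !mxE !mnmE !truncnK // addrK.
exists a, b; split=> //; apply: mnm_row_inj; apply/eqP; rewrite -subr_eq0 -!mnm_row_tdeg.
by rewrite -mulmxBl -NvE -scalemxAl vD scaler0.
Qed.

Lemma lead_row_free : (k <= m - \rank tdeg_mx)%N ->
  forall c : 'I_k -> rat, \sum_i c i *: lead_row i = 0 -> forall i, c i = 0.
Proof.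
move=> le_k c c0; pose M := \matrix_i lead_row i.
have sum_lead d : \sum_i d i *: lead_row i = \row_i d i *m M.
  by rewrite mulmx_sum_row; apply: eq_bigr => i _; rewrite mxE rowK.
have ker_sub : (kermx tdeg_mx <= M)%MS.
  apply/row_subP => r; set v := row r _.
  have [|N N0 [a [b [ab Nv]]]] := @kermx_tdeg_difference v.
    by rewrite -row_mul mulmx_ker row0.
  have [d dE _] := span_below_tdeg ab.
  by rewrite -[v](scalerK N0) Nv dE sum_lead scalemx_sub ?submxMl.
have M_free : row_free M.
  rewrite /row_free eqn_leq rank_leq_row; apply: leq_trans le_k _.
  by rewrite -mxrank_ker mxrankS.
have /(row_free_inj M_free)/rowP eq0 : \row_i c i *m M = 0 *m M.
  by rewrite mul0mx -sum_lead.
by move=> i; have := eq0 i; rewrite !mxE.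
Qed.

End MonomialDifferences.

Lemma toric_mmap_comp (K : fieldType) l m n (D : 'I_m -> 'X_{1..n}) (f : 'I_l -> 'I_m)
    (q : {mpoly K[l]}) :
  toric_mmap (D \o f) q = toric_mmap D (mmap (mpolyC m (R := K)) (fun i => 'X_(f i)) q).
Proof.
rewrite [LHS]/toric_mmap /mmap rmorph_sum; apply: eq_bigr => a _ /=.
rewrite rmorphM /= [toric_mmap D _%:MP]mmapC rmorph_prod; congr (_ * _).
by apply: eq_bigr => i _; rewrite rmorphXn /= toric_mmapX tdeg1.
Qed.

Section ToricIdeal.
Variables (K : fieldType) (m n : nat) (D : 'I_m -> 'X_{1..n}).

Definition toric_ker (p : mpoly K m) := toric_mmap D (to_mpoly p) = 0.

Lemma toric_ker_prime : is_prime_ideal toric_ker.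
Proof.
split; first split.
- by rewrite /toric_ker !raddf0.
- by move=> x y; rewrite /toric_ker !raddfD /= => -> ->; rewrite addr0.
- by move=> r x; rewrite /toric_ker !rmorphM /= => ->; rewrite mulr0.
- by rewrite /toric_ker !rmorph1 => /eqP; rewrite oner_eq0.
move=> x y; rewrite /toric_ker !rmorphM /= => /eqP.
by rewrite mulf_eq0 => /orP[] /eqP; [left|right].
Qed.

Lemma alg_indep_mod_toric_ker :
  exists a, alg_indep_mod toric_ker (\rank (tdeg_mx D)) a.
Proof.
pose f := maxrankfun (tdeg_mx D).
exists (extend_ord (fun i => mvar K m (f i))) => F; rewrite /toric_ker to_mpoly_meval.
rewrite [X in mmap _ X](_ : _ = fun i => 'X_(f i)); last first.
  by apply: funext => i; rewrite extend_ordE to_mpoly_mvar.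
rewrite -toric_mmap_comp => F0.
rewrite -[F]to_mpolyK (toric_mmap_inj _ F0) ?raddf0 // => s t st.
apply/mnm_row_inj/(row_free_inj (maxrowsub_free (tdeg_mx D))).
have row_tdeg s' : mnm_row s' *m rowsub f (tdeg_mx D) = mnm_row (tdeg (D \o f) s').
  by rewrite -mnm_row_tdeg; congr (_ *m _); apply/matrixP => i j; rewrite !mxE.
by rewrite !row_tdeg st.
Qed.

Definition mnm_row_diff (p : 'X_{1..m} * 'X_{1..m}) : 'rV[rat]_m :=
  mnm_row p.1 - mnm_row p.2.

Hypothesis tdeg_mdeg : forall a b, tdeg D a = tdeg D b -> mdeg a = mdeg b.

Theorem toric_markov_basis : complete_intersection toric_ker ->
  exists k (u : 'I_k -> 'X_{1..m} * 'X_{1..m}),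
  [/\ forall i, tdeg D (u i).1 = tdeg D (u i).2,
      forall c : 'I_k -> rat, \sum_i c i *: mnm_row_diff (u i) = 0 -> forall i, c i = 0
    & forall p, tdeg D p.1 = tdeg D p.2 -> exists2 c : 'I_k -> rat,
        mnm_row_diff p = \sum_i c i *: mnm_row_diff (u i)
        & forall i, c i != 0 -> (tdeg D (u i).1 <= tdeg D p.1)%MM].
Proof.
case=> g [g_gen g_height]; have [x x_indep] := alg_indep_mod_toric_ker.
have rank_le := ideal_height_leq toric_ker_prime g_height x_indep.
have [||s [s_uniq s_size s_lead]] :=
    enum_minimal_leads (K := K) tdeg_mdeg (g := fun k : 'I_(size g) => to_mpoly g`_k).
- move=> k; apply/(g_gen g`_k); exists (fun i : nat => (i == k :> nat)%:R).
  rewrite (bigD1 k) //= eqxx mul1r big1 ?addr0 // => i ik.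
  by rewrite (_ : (i == k :> nat) = false) ?mul0r //; apply: contraNF ik.
- move=> q q0; have [|c cE] := (g_gen (of_mpoly q)).1.
    by rewrite /toric_ker of_mpolyK.
  exists (fun k => to_mpoly (c k)); rewrite -[q in LHS]of_mpolyK cE rmorph_sum.
  by apply: eq_bigr => k _; rewrite rmorphM.
pose u (i : 'I_(size s)) := nth 0%MM s i.
have u_lead y : minimal_lead D y -> exists i, u i = y.
  move=> /s_lead ys; have lt_ys : (index y s < size s)%N by rewrite index_mem.
  by exists (Ordinal lt_ys); rewrite /u nth_index.
exists (size s), (fun i => (u i, fiber_base D (u i))); split => /=.
- by move=> i; rewrite tdeg_fiber_base.
- by apply: lead_row_free u_lead _ => //; lia.
- by move=> p /(span_below_tdeg tdeg_mdeg u_lead).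
Qed.

End ToricIdeal.

Section EdgeRing.
Variables (T : finType) (e : rel T).

Let m := #|gedges e|.
Let edge (i : 'I_m) : {set T} := enum_val i.
Implicit Types (a b : 'X_{1..m}) (r : 'rV[rat]_m) (w : weight T).

Definition edge_degree (i : 'I_m) : 'X_{1..#|T|} :=
  [multinom (enum_val v \in edge i : nat) | v < #|T|].

Lemma toric_idealE (K : fieldType) : @toric_ideal T e K = toric_ker (K := K) edge_degree.
Proof.
apply: funext => p; rewrite /toric_ideal /toric_ker.
suff <- : to_mpoly (toric_map p) = toric_mmap edge_degree (to_mpoly p).
  apply: propext; split=> [->|]; first by rewrite raddf0.
  by move/(canRL (@to_mpolyK _ _)); rewrite raddf0.
rewrite [RHS]mmap_to_mpoly /toric_map rmorph_meval.
apply: (eq_meval (f := @to_mpoly K _ \o mconst K _) (g := mpolyC _ (R := K))) => [c|i lin].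
  exact: to_mpoly_mconst.
rewrite -[i]/(val (Ordinal lin)); move: (Ordinal lin) => {lin}i.
rewrite extend_ordE /= /edge_image valK rmorph_prod /=.
under eq_bigr do rewrite to_mpoly_mvar.
rewrite mprodXE; congr 'X_[_]; apply/mnmP => j; rewrite mnm_sumE mnmE /edge.
have [j_in|j_out] := boolP (enum_val j \in _).
  rewrite (bigD1 _ j_in) /= mnm1E enum_valK eqxx big1 // => v /andP[_ vj].
  by rewrite mnm1E; case: eqVneq => // vE; rewrite -vE enum_rankK eqxx in vj.
rewrite big1 // => v v_in; rewrite mnm1E; case: eqVneq => // vE.
by rewrite -vE enum_rankK v_in in j_out.
Qed.

Lemma tdeg_edge_degree_mdeg a b : irreflexive e ->
  tdeg edge_degree a = tdeg edge_degree b -> mdeg a = mdeg b.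
Proof.
move=> e_irr; suff double c : mdeg (tdeg edge_degree c) = (2 * mdeg c)%N.
  by move=> ab; have := double a; rewrite ab double; lia.
rewrite mdeg_sum mdegE big_distrr /=; apply: eq_bigr => i _.
rewrite mdegMn; congr (_ * _)%N; rewrite mdegE.
rewrite -(card_gedge e_irr (enum_valP i)) -[RHS]sum1_card [RHS]big_mkcond.
rewrite (reindex _ (onW_bij _ (enum_rank_bij T))) /=.
by apply: eq_bigr => v _; rewrite mnmE enum_rankK; case: (v \in _).
Qed.

Definition row_weight r : weight T := \sum_i r 0 i *: indicator (edge i).

Lemma row_weight_is_linear : linear row_weight.
Proof.
move=> c r s; rewrite /row_weight scaler_sumr -big_split; apply: eq_bigr => i _.
by rewrite !mxE scalerDl scalerA.
Qed.
HB.instance Definition _ :=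
  GRing.isLinear.Build rat 'rV[rat]_m (weight T) *:%R row_weight row_weight_is_linear.

Lemma row_weight_edge r i : row_weight r (edge i) = r 0 i.
Proof.
rewrite sum_ffunE (bigD1 i) //= !ffunE eqxx [_ *: _]mulr1 big1 ?addr0 // => j ji.
by rewrite !ffunE (inj_eq enum_val_inj) eq_sym (negPf ji) scaler0.
Qed.

Lemma row_weight_inj : injective row_weight.
Proof. by move=> r s rs; apply/rowP => i; rewrite -!row_weight_edge rs. Qed.

Lemma row_weight_supported r : row_weight r \in edge_supported e setT.
Proof.
apply: rpred_sum => i _; apply: rpredZ; rewrite /edge.
have /gedgeP[x [y [exy ->]]] := enum_valP i.
exact: indicator_supported.
Qed.

Lemma row_weightK w : w \in edge_supported e setT -> row_weight (\row_i w (edge i)) = w.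
Proof.
move=> wT; apply/ffunP => E; have [Ein|Eout] := boolP (E \in gedges e).
  by rewrite -(enum_rankK_in Ein Ein) row_weight_edge mxE.
have off_edges w' : w' \in edge_supported e setT -> w' E = 0.
  by move=> /edge_supportedP/(_ E) w'E; apply/eqP; apply: contraNT Eout => /w'E[].
by rewrite !off_edges ?row_weight_supported.
Qed.

Lemma vsum_row_weight a v :
  vsum v (row_weight (mnm_row a)) = (tdeg edge_degree a (enum_rank v))%:R.
Proof.
rewrite raddf_sum tdegE natr_sum; apply: eq_bigr => i _ /=.
by rewrite linearZ /= vsum_indicator !mxE mnmE enum_rankK natrM mulrC.
Qed.

Lemma multiset_row_weight a : multiset e (row_weight (mnm_row a)).
Proof.
split=> [|E]; first exact: row_weight_supported.
by rewrite sum_ffunE rpred_sum // => i _; rewrite !ffunE !mxE rpredM ?natr_nat.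
Qed.

Lemma multisetP w : multiset e w -> exists a, w = row_weight (mnm_row a).
Proof.
move=> [wT w_nat]; exists [multinom Num.truncn (w (edge i)) | i < m].
rewrite -[LHS]row_weightK //; congr row_weight; apply/rowP => i.
by rewrite !mxE mnmE truncnK.
Qed.

Definition row_weight_pair (p : 'X_{1..m} * 'X_{1..m}) : weight T * weight T :=
  (row_weight (mnm_row p.1), row_weight (mnm_row p.2)).

Lemma exponent_diff_row_weight_pair p :
  exponent_diff (row_weight_pair p) = row_weight (mnm_row_diff p).
Proof. by rewrite [RHS]raddfB. Qed.

Lemma toric_binomial_row_weight_pair p :
  toric_binomial e (row_weight_pair p) <-> tdeg edge_degree p.1 = tdeg edge_degree p.2.
Proof.
split=> [[_ _ eq_deg]|eq_deg].
  apply/mnmP => j; have := eq_deg (enum_val j); rewrite !vsum_row_weight enum_valK.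
  by move/eqP; rewrite eqr_nat => /eqP.
by split=> [||v]; rewrite ?vsum_row_weight ?eq_deg //; apply: multiset_row_weight.
Qed.

Theorem graph_markov_basis (K : fieldType) : irreflexive e -> graph_CI e K ->
  exists k (u : 'I_k -> weight T * weight T), markov_family e u.
Proof.
move=> e_irr; have tdeg_mdeg a b := @tdeg_edge_degree_mdeg a b e_irr.
rewrite /graph_CI toric_idealE.
move=> /(toric_markov_basis tdeg_mdeg)[k [u [u_deg u_free u_span]]].
have sum_u c : \sum_i c i *: exponent_diff (row_weight_pair (u i)) =
    row_weight (\sum_i c i *: mnm_row_diff (u i)).
  rewrite raddf_sum; apply: eq_bigr => i _ /=.
  by rewrite linearZ exponent_diff_row_weight_pair.
exists k, (fun i => row_weight_pair (u i)); split.
- by move=> i; apply/toric_binomial_row_weight_pair.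
- by move=> c; rewrite sum_u => c0; apply/u_free/row_weight_inj; rewrite c0 raddf0.
move=> [wa wb] [/= /multisetP[a ->] /multisetP[b ->] ab].
have /u_span[c cE c_le] : tdeg edge_degree (a, b).1 = tdeg edge_degree (a, b).2.
  by apply/toric_binomial_row_weight_pair; split=> //; apply: multiset_row_weight.
exists c => [|i /c_le/mnm_lepP le v]; last by rewrite !vsum_row_weight ler_nat.
by rewrite sum_u -cE -exponent_diff_row_weight_pair.
Qed.

End EdgeRing.

End ToricAlgebra.
Import ToricAlgebra.

(** * Walks, blocks and cut vertices *)

Section InducedPaths.
Local Open Scope nat_scope.
Variables (T : finType) (e : rel T).
Hypothesis e_sym : symmetric e.
Implicit Types (S : {set T}) (x y z v w : T) (p q : seq T).

Lemma inducedE S x y : induced e S x y = [&& x \in S, y \in S & e x y].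
Proof. by []. Qed.

Lemma induced_sym S : symmetric (induced e S).
Proof. by move=> x y; rewrite !inducedE e_sym andbCA. Qed.

Lemma inducedS S S' : S \subset S' -> subrel (induced e S) (induced e S').
Proof. by move=> /subsetP sub x y; rewrite !inducedE => /and3P[/sub-> /sub->]. Qed.

Lemma induced_subrel S : subrel (induced e S) e.
Proof. by move=> x y /and3P[]. Qed.

Lemma path_induced_subset S x p : path (induced e S) x p -> {subset p <= S}.
Proof.
elim: p x => //= y p IH x /andP[/and3P[_ yS _]] /IH pS z.
by rewrite inE => /predU1P[->//|/pS].
Qed.

Lemma path_induced S x p : {subset x :: p <= S} -> path e x p -> path (induced e S) x p.
Proof.
elim: p x => //= y p IH x xpS /andP[exy yp].
rewrite inducedE exy !xpS ?inE ?eqxx ?orbT //= IH // => z zp.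
by apply: xpS; rewrite inE zp orbT.
Qed.

Lemma rev_path_induced S x q z : path (induced e S) x (rcons q z) ->
  path (induced e S) z (rcons (rev q) x).
Proof.
have := rev_path (induced e S) x (rcons q z).
rewrite last_rcons belast_rcons rev_cons => ->.
by apply: sub_path => u v; rewrite induced_sym.
Qed.

Lemma connect_inducedS S S' x z : S \subset S' ->
  connect (induced e S) x z -> connect (induced e S') x z.
Proof. by move=> sub; apply: connect_sub => u v uv; apply/connect1/(inducedS sub). Qed.

Lemma connect_induced_sym S x z :
  connect (induced e S) x z = connect (induced e S) z x.
Proof. exact: (sym_connect_sym (@induced_sym S)). Qed.

Lemma path_connect_induced S x p :
  {subset x :: p <= S} -> path e x p -> connect (induced e S) x (last x p).
Proof. by move=> xpS xp; apply/connectP; exists p => //; apply: path_induced. Qed.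

Lemma connected_inP S :
  reflect {in S &, forall x z, connect (induced e S) x z} (connected_in e S).
Proof.
apply: (iffP forall_inP) => [conn x z /conn/forall_inP|conn x xS]; first exact.
by apply/forall_inP => z; apply: conn.
Qed.

Lemma connected_in_extend A S : connected_in e A -> A \subset S ->
  (forall w, w \in S -> exists2 h, h \in A & connect (induced e S) w h) ->
  connected_in e S.
Proof.
move=> /connected_inP connA AS toA; apply/connected_inP => x z /toA[h hA xh] /toA[k kA zk].
apply: (connect_trans xh); rewrite connect_induced_sym in zk.
by apply: connect_trans zk; apply: connect_inducedS AS (connA _ _ hA kA).
Qed.

End InducedPaths.
Arguments connected_inP {T e S}.

Section OddClosedWalks.
Local Open Scope nat_scope.
Variables (T : finType) (e : rel T).
Hypotheses (e_sym : symmetric e) (e_irr : irreflexive e).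
Implicit Types (S : {set T}) (x y z v : T) (s p q c w : seq T).

Definition odd_closed_walk S s := cycle (induced e S) s && odd (size s).

Lemma odd_closed_walk_rot S i s : odd_closed_walk S (rot i s) = odd_closed_walk S s.
Proof. by rewrite /odd_closed_walk rot_cycle size_rot. Qed.

Lemma odd_closed_walk_cons S x s : odd_closed_walk S (x :: s) =
  path (induced e S) x (rcons s x) && ~~ odd (size s).
Proof. by []. Qed.

Lemma odd_closed_walk_subset S s : odd_closed_walk S s -> {subset s <= S}.
Proof.
case/andP=> + _ x xs; case: s xs => // y s xs /= /path_induced_subset; apply.
by rewrite mem_rcons.
Qed.

Lemma odd_closed_walkS S S' s :
  S \subset S' -> odd_closed_walk S s -> odd_closed_walk S' s.
Proof.
move=> sub /andP[+ odd_s]; rewrite /odd_closed_walk odd_s andbT.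
by case: s {odd_s} => //= x s; apply/sub_path/inducedS.
Qed.

Lemma odd_closed_walk_split S x s1 s2 : odd_closed_walk S (x :: s1 ++ x :: s2) ->
  odd_closed_walk S (x :: s1) || odd_closed_walk S (x :: s2).
Proof.
rewrite !odd_closed_walk_cons rcons_cat cat_path /= !rcons_path size_cat /= addnS oddS.
rewrite negbK oddD => /andP[/and4P[-> -> -> ->]] /=.
by case: (odd (size s1)); case: (odd (size s2)).
Qed.

(* The two closed walks obtained by replacing one of the two arcs between [x] and
   [z] have lengths of different parity. *)
Lemma odd_closed_walk_detour S x z s1 s2 q :
  odd_closed_walk S (x :: s1 ++ z :: s2) -> path (induced e S) x (rcons q z) ->
  odd_closed_walk S (x :: s1 ++ z :: rev q) || odd_closed_walk S (x :: q ++ z :: s2).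
Proof.
rewrite !odd_closed_walk_cons !rcons_cat !cat_path /= => /andP[/and3P[-> -> ->] parity] xqz.
rewrite (rev_path_induced e_sym xqz); move: xqz; rewrite rcons_path => /andP[-> ->] /=.
move: parity; rewrite !size_cat /= !addnS /= !negbK !oddD size_rev.
by case: (odd (size s1)); case: (odd (size s2)); case: (odd (size q)).
Qed.

Definition shortest_odd_closed_walk S s :=
  odd_closed_walk S s /\ forall s', odd_closed_walk S s' -> size s <= size s'.

Lemma shortest_odd_closed_walk_rot S i s :
  shortest_odd_closed_walk S s -> shortest_odd_closed_walk S (rot i s).
Proof. by case=> ws s_min; split; rewrite ?odd_closed_walk_rot ?size_rot. Qed.

Lemma shortest_odd_closed_walk_uniq S s : shortest_odd_closed_walk S s -> uniq s.
Proof.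
move=> s_short; apply: count_mem_uniq => x; have [xs|/count_memPn//] := boolP (x \in s).
have [i s' sE] := rot_to xs; have := shortest_odd_closed_walk_rot i s_short.
have /permP <- : perm_eq (rot i s) s by rewrite perm_rot.
rewrite sE /= eqxx => -[ws' s'_min]; suff /count_memPn -> : x \notin s' by [].
apply/negP => xs'; case/splitPr: xs' ws' s'_min => s1 s2.
by move=> /odd_closed_walk_split/orP[] w /(_ _ w); rewrite /= size_cat /=; lia.
Qed.

Lemma shortest_odd_closed_walk_chord S s x y : shortest_odd_closed_walk S s ->
  x \in s -> y \in s -> e x y -> (y == next s x) || (x == next s y).
Proof.
move=> s_short xs ys exy; have s_uniq := shortest_odd_closed_walk_uniq s_short.
have [i s' sE] := rot_to xs.
have xy := irreflexive_neq e_irr exy.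
have ys' : y \in s' by move: ys; rewrite -(mem_rot i) sE inE (negPf xy).
have := shortest_odd_closed_walk_rot i s_short; rewrite -!(next_rot i s_uniq).
move: s_uniq; rewrite -(rot_uniq i) sE; case/splitPr: ys' => s1 s2 s_uniq [ws s_min].
have wS := odd_closed_walk_subset ws.
have xy_path : path (induced e S) x (rcons [::] y).
  by rewrite /= inducedE !wS ?exy // ?inE ?mem_cat ?inE ?eqxx ?orbT.
have /orP[w|w] := odd_closed_walk_detour ws xy_path; have := s_min _ w;
    rewrite /= !size_cat /= ?size_rev => le_size.
  have s2E : s2 = [::] by case: (s2) le_size => //= z s3; clear; lia.
  apply/orP; right; move: s_uniq; rewrite s2E cats1 => s_uniq.
  rewrite -[X in _ == X]/(next (x :: rcons s1 y) y) -(next_rotr 1 s_uniq).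
  by rewrite -rcons_cons rotr1_rcons /= eqxx.
have s1E : s1 = [::] by case: (s1) le_size => //= z s3; clear; lia.
by rewrite s1E /= eqxx eqxx.
Qed.

Lemma shortest_odd_closed_walk_chordless S s :
  shortest_odd_closed_walk S s -> chordless_cycle_seq e s.
Proof.
move=> s_short; have [/andP[s_cycle s_odd] _] := s_short; apply/and4P; split.
- exact: shortest_odd_closed_walk_uniq s_short.
- case: s s_cycle s_odd {s_short} => [|x [|x' [|x'' s]]] //=.
  by rewrite inducedE e_irr !andbF.
- by case: (s) s_cycle => //= x s'; apply/sub_path/induced_subrel.
apply/allP => x xs; apply/allP => y ys; apply/implyP.
exact: shortest_odd_closed_walk_chord s_short xs ys.
Qed.

Lemma odd_closed_walk_of_paths S x0 p q : x0 \in S ->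
  path (induced e S) x0 p -> path (induced e S) x0 q -> e (last x0 p) (last x0 q) ->
  odd (size p) = odd (size q) -> exists s, odd_closed_walk S s.
Proof.
move=> x0S x0p x0q exy parity.
have lastS r : path (induced e S) x0 r -> last x0 r \in S.
  by move=> /path_induced_subset rS; have := mem_last x0 r; rewrite inE => /predU1P[->|/rS].
case/lastP: q => [|q y] in x0q exy parity *.
  exists (x0 :: p); rewrite odd_closed_walk_cons rcons_path x0p parity /=.
  by rewrite inducedE lastS // x0S exy.
rewrite last_rcons in exy; exists (x0 :: p ++ y :: rev q).
rewrite odd_closed_walk_cons rcons_cat cat_path x0p /= inducedE exy lastS //=.
rewrite (rev_path_induced e_sym x0q) -[y in y \in S](last_rcons x0 q) lastS //=.
by rewrite size_cat oddD /= size_rev parity size_rcons addbb.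
Qed.

Lemma nonbipartite_odd_closed_walk S :
  connected_in e S -> ~ bipartite_in e S -> exists s, odd_closed_walk S s.
Proof.
move=> /connected_inP conn not_bip; apply: contrapT => no_walk; apply: not_bip.
have [->|[x0 x0S]] := set_0Vmem S; first by exists (fun=> true) => x y; rewrite inE.
pose odd_to z := exists p, [/\ path (induced e S) x0 p, last x0 p = z & odd (size p)].
exists (fun z => `[< odd_to z >]) => x y xS yS exy.
have parity p q : path (induced e S) x0 p -> last x0 p = x ->
    path (induced e S) x0 q -> last x0 q = y -> odd (size p) != odd (size q).
  move=> x0p px x0q qy; apply/eqP => same; apply: no_walk.
  by apply: odd_closed_walk_of_paths x0S x0p x0q _ same; rewrite px qy.
have [/connectP[p x0p px] /connectP[q x0q qy]] := (conn _ _ x0S xS, conn _ _ x0S yS).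
have odd_toE z r : path (induced e S) x0 r -> last x0 r = z -> odd (size r) -> odd_to z.
  by exists r.
case: asboolP => [[p' [x0p' p'x odd_p']]|not_x];
  case: asboolP => [[q' [x0q' q'y odd_q']]|not_y] //.
  by have := parity _ _ x0p' p'x x0q' q'y; rewrite odd_p' odd_q'.
have := parity _ _ x0p (esym px) x0q (esym qy).
case: (boolP (odd (size p))) => [/(odd_toE _ _ x0p (esym px))//|_].
by case: (boolP (odd (size q))) => [/(odd_toE _ _ x0q (esym qy))|].
Qed.

Lemma exists_shortest_odd_closed_walk S : connected_in e S -> ~ bipartite_in e S ->
  exists s, shortest_odd_closed_walk S s.
Proof.
move=> conn not_bip; have [s0 ws0] := nonbipartite_odd_closed_walk conn not_bip.
have ex : exists k, `[< exists2 s, odd_closed_walk S s & size s = k >].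
  by exists (size s0); apply/asboolP; exists s0.
case: (ex_minnP ex) => k /asboolP[s ws sk] k_min; exists s; split=> // s' ws'.
by rewrite sk; apply: k_min; apply/asboolP; exists s'.
Qed.

Lemma chordless_odd_closed_walk S s : chordless_cycle_seq e s -> odd (size s) ->
  {subset s <= S} -> odd_closed_walk S s.
Proof.
move=> /and4P[_ _ s_cycle _] s_odd sS; rewrite /odd_closed_walk s_odd andbT.
case: s s_cycle sS {s_odd} => //= x s xs sS; apply: path_induced xs => z.
by rewrite inE mem_rcons inE orbA orbb -in_cons => /sS.
Qed.

Lemma odd_closed_walk_through_common_neighbour S y s z1 z2 : odd_closed_walk S s ->
  y \in S -> z1 \in s -> z2 \in s -> z1 != z2 -> e y z1 -> e y z2 ->
  exists2 d, odd_closed_walk S (y :: d) & size (y :: d) <= size s.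
Proof.
move=> ws yS z1s z2s z12 eyz1 eyz2; have [i r sE] := rot_to z1s.
have z2r : z2 \in r by move: z2s; rewrite -(mem_rot i) sE inE eq_sym (negPf z12).
have sS := odd_closed_walk_subset ws; have [z1S z2S] := (sS _ z1s, sS _ z2s).
rewrite -(size_rot i s); move: ws; rewrite -(odd_closed_walk_rot S i) sE.
case/splitPr: z2r => s1 s2 ws; have /andP[_ /=] := ws; rewrite !size_cat /= => parity.
have detour : path (induced e S) z1 (rcons [:: y] z2).
  by rewrite /= !inducedE z1S yS z2S e_sym eyz1 eyz2.
have /orP[w|w] := odd_closed_walk_detour ws detour; have /andP[_ /=] := w;
    rewrite ?size_cat /= => parity'.
  exists (z1 :: s1 ++ [:: z2]).
    by rewrite -(odd_closed_walk_rot S 1) rot1_cons -cats1 /= -catA.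
  by rewrite /= size_cat /=; move: parity parity'; clear; lia.
exists (rcons (z2 :: s2) z1).
  by rewrite -rcons_cons -rot1_cons odd_closed_walk_rot.
by rewrite /= size_rcons; move: parity parity'; clear; lia.
Qed.

Definition based_odd_walk S y s := odd_closed_walk S (y :: s) && (y \notin s).

Lemma based_odd_walkS S S' y s :
  S \subset S' -> based_odd_walk S y s -> based_odd_walk S' y s.
Proof. by move=> sub /andP[w ys]; rewrite /based_odd_walk (odd_closed_walkS sub). Qed.

Lemma odd_closed_walk_based S y s :
  odd_closed_walk S (y :: s) -> exists s', based_odd_walk S y s'.
Proof.
have [k] := ubnP (size s); elim: k => // k IH in s * => sk ws.
have [ys|ys] := boolP (y \in s); last by exists s; rewrite /based_odd_walk ws.
case/splitPr: ys ws sk => s1 s2 /odd_closed_walk_split/orP[] w.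
  by rewrite size_cat /= => sk; apply: IH w; lia.
by rewrite size_cat /= => sk; apply: IH w; lia.
Qed.

Lemma attach_odd_closed_walk S y q z s : path (induced e S) y (rcons q z) ->
  y \notin rcons q z -> odd_closed_walk S s -> z \in s -> y \notin s ->
  exists2 w, based_odd_walk S y w
    & forall v, v \notin rcons q z -> count_mem v w = count_mem v s.
Proof.
move=> yqz yq ws zs ys; have [i c sE] := rot_to zs.
have mem_c x : (x \in z :: c) = (x \in s) by rewrite -sE mem_rot.
have count_c v : count_mem v (z :: c) = count_mem v s.
  by rewrite -sE; apply/permP; rewrite perm_rot.
move: ws; rewrite -(odd_closed_walk_rot S i) sE => /andP[/= zc c_even].
exists (rcons q z ++ rcons c z ++ rev q) => [|v].
  rewrite /based_odd_walk odd_closed_walk_cons !rcons_cat !cat_path !last_rcons yqz zc /=.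
  rewrite (rev_path_induced e_sym yqz) !mem_cat mem_rev !negb_or yq mem_rcons mem_c ys /=.
  move: yq; rewrite mem_rcons inE negb_or => /andP[_ ->]; move: c_even.
  rewrite !size_cat !size_rcons size_rev !oddD /=.
  by case: (odd (size c)); case: (odd (size q)).
rewrite mem_rcons inE negb_or => /andP[vz vq]; rewrite !count_cat -!cats1 !count_cat /=.
by rewrite count_rev !(count_memPn vq) -count_c /= eq_sym (negPf vz) !addn0.
Qed.

Lemma connect_based_odd_walk S y z s : odd_closed_walk S s -> z \in s ->
  connect (induced e S) y z -> exists w, based_odd_walk S y w.
Proof.
move=> ws zs; have [ys _|ys] := boolP (y \in s).
  have [i r sE] := rot_to ys; apply: (@odd_closed_walk_based _ _ r).
  by rewrite -sE odd_closed_walk_rot.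
case/connect_uniq_path => [|q yq /andP[yqz _]]; first by apply: contraNneq ys => ->.
by have [w bw _] := attach_odd_closed_walk yq yqz ws zs ys; exists w.
Qed.

End OddClosedWalks.

Section Blocks.
Local Open Scope nat_scope.
Variables (T : finType) (e : rel T).
Hypotheses (e_sym : symmetric e) (e_irr : irreflexive e).
Implicit Types (S V B C : {set T}) (x y z v w : T) (p q s : seq T).

Lemma biconnectedP S :
  reflect (1 < #|S| /\ forall V, #|V| <= 1 -> connected_in e (S :\: V)) (biconnected e S).
Proof.
apply: (iffP and3P) => [[S_gt1 connS /forall_inP connD]|[S_gt1 connD]].
  split=> // V; rewrite leq_eqVlt ltnS leqn0 cards_eq0.
  case/predU1P=> [/eqP/cards1P[v ->]|/eqP->]; last by rewrite setD0.
  have [/connD//|vS] := boolP (v \in S).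
  by have /setDidPl -> : [disjoint S & [set v]] by rewrite disjoint_sym disjoints1.
split=> //; first by rewrite -[S]setD0 connD // cards0.
by apply/forall_inP => v _; rewrite connD ?cards1.
Qed.

Lemma biconnected_connected S : biconnected e S -> connected_in e S.
Proof. by case/and3P. Qed.

Lemma biconnected_connectedD1 S v : biconnected e S -> connected_in e (S :\ v).
Proof. by case/biconnectedP=> _; apply; rewrite cards1. Qed.

Lemma biconnected_neighbour S y :
  biconnected e S -> y \in S -> exists2 w, w \in S & e y w.
Proof.
move=> biS yS; have /and3P[S_gt1 /connected_inP connS _] := biS.
have /card_gt0P[z] : 0 < #|S :\ y| by rewrite (cardsD1 y) yS in S_gt1.
rewrite !inE => /andP[zy zS]; case/connectP: (connS _ _ yS zS) => -[|w p] /=.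
  by move=> _ yz; rewrite yz eqxx in zy.
by case/andP=> /and3P[_ wS eyw] _ _; exists w.
Qed.

Lemma biconnectedU B C x y : biconnected e B -> biconnected e C -> x != y ->
  x \in B -> y \in B -> x \in C -> y \in C -> biconnected e (B :|: C).
Proof.
move=> /biconnectedP[B_gt1 connB] /biconnectedP[_ connC] xy xB yB xC yC.
apply/biconnectedP; split=> [|V V_le1].
  by rewrite (leq_trans B_gt1) // subset_leq_card // subsetUl.
have [h /setDP[/setIP[hB hC] hV]] : exists h, h \in (B :&: C) :\: V.
  have [xV|xV] := boolP (x \in V); last by exists x; rewrite !inE xB xC xV.
  exists y; rewrite !inE yB yC !andbT; apply: contraNN xy => yV; apply/eqP.
  exact: (card_le1_eqP V_le1).
apply: (connected_in_extend e_sym (connB V V_le1)); first by rewrite setSD // subsetUl.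
move=> w /setDP[/setUP[wB|wC] wV]; first by exists w; rewrite ?connect0 // !inE wB wV.
exists h; first by rewrite !inE hB hV.
apply: (@connect_inducedS _ _ (C :\: V)); first by rewrite setSD // subsetUr.
by apply: (connected_inP (connC V V_le1)); rewrite !inE ?wC ?hC ?wV ?hV.
Qed.

Lemma biconnected_ear B x y q : biconnected e B -> x \in B -> y \in B ->
  path e x (rcons q y) -> uniq (x :: rcons q y) ->
  biconnected e (B :|: [set w in q]).
Proof.
move=> /biconnectedP[B_gt1 connB] xB yB xqy xqy_uniq; set S := B :|: _.
have BS : B \subset S by rewrite subsetUl.
have inS w : w \in x :: rcons q y -> w \in S.
  by rewrite inE mem_rcons !inE => /or3P[/eqP->|/eqP->|->]; rewrite ?xB ?yB ?orbT.
apply/biconnectedP; split=> [|V V_le1]; first by rewrite (leq_trans B_gt1) ?subset_leq_card.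
apply: (connected_in_extend e_sym (connB V V_le1)); first by rewrite setSD.
move=> w /setDP[wS wV]; have [wB|wB] := boolP (w \in B).
  by exists w; rewrite ?connect0 // !inE wB wV.
have wq : w \in q by move: wS; rewrite !inE (negPf wB).
case/splitPr: wq => q1 q2 in xqy xqy_uniq inS *.
move: xqy; rewrite rcons_cat cat_path => /andP[xq1 /= /andP[q1w wq2y]].
have [/hasP[v vq1 vV]|/hasPn q1V] := boolP (has (mem V) (x :: q1)).
  exists y; last first.
    rewrite -(last_rcons w q2 y); apply: path_connect_induced => // v' v'q2.
    rewrite in_setD inS; last by rewrite rcons_cat -cat_cons mem_cat v'q2 orbT.
    rewrite andbT; apply/negP => v'V; move: xqy_uniq.
    rewrite rcons_cat -cat_cons cat_uniq => /and3P[_ /hasPn/(_ _ v'q2) + _].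
    by rewrite (card_le1_eqP V_le1 _ _ vV v'V) vq1.
  rewrite !inE yB andbT; apply/negP => yV; move: xqy_uniq.
  rewrite -rcons_cons rcons_uniq => /andP[+ _].
  by rewrite (card_le1_eqP V_le1 _ _ vV yV) -cat_cons mem_cat vq1.
exists x; first by rewrite !inE xB q1V ?inE ?eqxx.
rewrite connect_induced_sym // -(last_rcons x q1 w); apply: path_connect_induced.
  move=> v; rewrite -rcons_cons mem_rcons inE in_setD.
  case/predU1P=> [->|vq1]; first by rewrite wV.
  by rewrite q1V // inS // rcons_cat -cat_cons mem_cat vq1.
by rewrite rcons_path xq1.
Qed.

Lemma block_maximal B S : is_block e B -> biconnected e S -> B \subset S -> S \subset B.
Proof.
move=> /andP[_ /forallP/(_ S)/implyP maxB] biS BS; apply: contraT => SB.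
by have /negP[] : ~~ biconnected e S by rewrite maxB // properE BS.
Qed.

Lemma eq_block B C x y : is_block e B -> is_block e C -> x != y ->
  x \in B -> y \in B -> x \in C -> y \in C -> B = C.
Proof.
move=> blB blC xy xB yB xC yC; have [[biB _] [biC _]] := (andP blB, andP blC).
have biU := biconnectedU biB biC xy xB yB xC yC.
apply/eqP; rewrite eqEsubset.
rewrite (subset_trans (subsetUl B C)) ?(block_maximal blC) ?subsetUr //=.
by rewrite (subset_trans (subsetUr B C)) // (block_maximal blB) ?subsetUl.
Qed.

Lemma block_ear_subset B x y q : is_block e B -> x \in B -> y \in B ->
  path e x (rcons q y) -> uniq (x :: rcons q y) -> {subset q <= B}.
Proof.
move=> blB xB yB xqy xqy_uniq w wq; have [biB _] := andP blB.
apply: (subsetP (block_maximal blB (biconnected_ear biB xB yB xqy xqy_uniq) _)).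
  exact: subsetUl.
by rewrite !inE wq orbT.
Qed.

(* A path from [x] to [z] off [y], continued inside [C] to a neighbour of [y] and
   then to [y], is an ear of [B] with a vertex of [C]. *)
Lemma blocks_separated B C y x z : is_block e B -> is_block e C -> B != C ->
  y \in B -> y \in C -> x \in B -> z \in C -> x != y -> z != y ->
  ~~ connect (induced e ([set: T] :\ y)) x z.
Proof.
move=> blB blC BC yB yC xB zC xy zy; have [biC _] := andP blC.
apply: contraNN BC => xz; apply/eqP; have [w wC eyw] := biconnected_neighbour biC yC.
have wy := irreflexive_neq e_irr eyw.
have {xz z zC zy} conn_xw : connect (induced e ([set: T] :\ y)) x w.
  apply: (connect_trans xz); apply: (@connect_inducedS _ _ (C :\ y)).
    by rewrite setSD ?subsetT.
  by apply: (connected_inP (biconnected_connectedD1 y biC)); rewrite !inE ?zy ?wy.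
suff wB : w \in B by apply: (eq_block blB blC wy).
have [<-//|xw] := eqVneq x w; have [q xq q_uniq] := connect_uniq_path xw conn_xw.
have yq : y \notin x :: rcons q w.
  rewrite inE negb_or eq_sym xy; apply/negP => /(path_induced_subset xq).
  by rewrite !inE eqxx.
apply: (block_ear_subset blB xB yB (q := rcons q w)); last by rewrite mem_rcons mem_head.
  rewrite rcons_path last_rcons e_sym eyw andbT.
  by apply: sub_path xq; apply: induced_subrel.
by rewrite -rcons_cons rcons_uniq yq.
Qed.

Lemma odd_closed_walk_avoiding B y s v : biconnected e B -> y \in B ->
  odd_closed_walk e B s -> uniq s -> 1 < size s -> v != y ->
  exists2 w, based_odd_walk e B y w & count_mem v w <= (v \in s).
Proof.
move=> biB yB ws s_uniq s_gt1 vy; have [ys|ys] := boolP (y \in s).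
  have [i w sE] := rot_to ys; move: s_uniq ws.
  rewrite -(rot_uniq i) -(odd_closed_walk_rot _ _ i) sE => /andP[yw w_uniq] bw.
  exists w; first by rewrite /based_odd_walk bw.
  by rewrite count_uniq_mem // -(mem_rot i s) sE inE (negPf vy).
have [p ps pv] : exists2 p, p \in s & p != v.
  case: s s_uniq s_gt1 {ws ys} => [|p1 [|p2 s]] //=; rewrite inE negb_or -andbA.
  case/and3P=> p12 _ _ _.
  have [p1v|p1v] := eqVneq p1 v; last by exists p1; rewrite ?inE ?eqxx.
  by exists p2; rewrite ?inE ?eqxx ?orbT // -p1v eq_sym.
have : connect (induced e (B :\ v)) y p.
  apply: (connected_inP (biconnected_connectedD1 v biB)).
    by rewrite !inE eq_sym vy.
  by rewrite !inE pv (odd_closed_walk_subset ws).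
case/connect_uniq_path => [|q yq /andP[q_y _]]; first by apply: contraNneq ys => ->.
have yq_B : path (induced e B) y (rcons q p) by apply: sub_path yq; apply/inducedS/subD1set.
have [w bw w_count] := attach_odd_closed_walk e_sym yq_B q_y ws ps ys.
exists w => //; rewrite w_count ?count_uniq_mem //.
by apply/negP => /(path_induced_subset yq); rewrite !inE eqxx.
Qed.

End Blocks.

Definition cut_side (T : finType) (e : rel T) (y : T) (H : {set T}) : Prop :=
  y \in H /\ forall x z, e x z -> x \in H -> z \notin H -> x = y.

Section CutSides.
Variables (T : finType) (e : rel T).
Hypotheses (e_sym : symmetric e) (e_irr : irreflexive e).
Variables (y k : T).
Hypothesis eyk : e y k.
Implicit Types (S B C : {set T}) (x z v w : T).

Definition branch : {set T} := [set x | connect (induced e ([set: T] :\ y)) k x].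

Let ky : k != y. Proof. exact: irreflexive_neq eyk. Qed.

Lemma branch_root : k \in branch.
Proof. by rewrite inE connect0. Qed.

Lemma pole_notin_branch : y \notin branch.
Proof.
rewrite inE; apply/negP => /connectP[q kq]; case/lastP: q kq => [_ /= yk|q w kq].
  by move: ky; rewrite yk eqxx.
rewrite last_rcons => yw; have := path_induced_subset kq (_ : w \in rcons q w).
by rewrite mem_rcons inE eqxx -yw !inE eqxx => /(_ isT).
Qed.

Lemma branch_neq x : x \in branch -> x != y.
Proof. by apply: contraTneq => ->; apply: pole_notin_branch. Qed.

Lemma branch_closed x z : x \in branch -> e x z -> z != y -> z \in branch.
Proof.
move=> xR exz zy; move: (branch_neq xR) (xR); rewrite !inE => xy /connect_trans; apply.
by apply: connect1; rewrite inducedE !inE xy zy.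
Qed.

Lemma branch_cut_side : cut_side e y (~: branch).
Proof.
split=> [|x z exz]; first by rewrite inE pole_notin_branch.
rewrite !in_setC negbK => xR zR; apply/eqP; apply: contraNT xR => xy.
by rewrite (branch_closed zR) // e_sym.
Qed.

Lemma biconnected_sub_branch S x :
  biconnected e S -> x \in S -> x \in branch -> S :\ y \subset branch.
Proof.
move=> biS xS xR; have xy := branch_neq xR.
apply/subsetP => w wS; move: xR; rewrite !inE => /connect_trans; apply.
apply: (@connect_inducedS _ _ (S :\ y)); first by rewrite setSD ?subsetT.
by apply: (connected_inP (biconnected_connectedD1 y biS)); rewrite // !inE xy.
Qed.

Lemma branch_btree_path S (p : seq ({set T} + T)) B :
  S :\ y \subset branch -> path (btree_adj e) (inl S) p -> inr y \notin p ->
  last (inl S) p = inl B -> B :\ y \subset branch.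
Proof.
pose in_branch (X : {set T} + T) :=
  match X with inl A => A :\ y \subset branch | inr v => v \in branch end.
rewrite -/(in_branch (inl S)) -/(in_branch (inl B)) => + + + <-.
elim: p (inl S) => //= Y p IH X X_in /andP[XY Yp]; rewrite inE negb_or => /andP[Yy yp].
apply: IH => //; case: X Y X_in XY Yy {Yp} => [S'|v] [S''|v'] //=.
  move=> /subsetP S'_in /and3P[_ _ vS'] vy; apply: S'_in; rewrite !inE vS' andbT.
  by apply: contraNneq vy => ->.
by move=> v_in /and3P[/andP[biS'' _] _ vS''] _; apply: biconnected_sub_branch vS'' v_in.
Qed.

Lemma branch_connected w :
  w \in y |: branch -> connect (induced e (y |: branch)) y w.
Proof.
rewrite in_setU1 => /predU1P[->|wR]; first exact: connect0.
apply: (@connect_trans _ _ k).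
  by apply: connect1; rewrite inducedE !in_setU1 eqxx branch_root orbT.
move: wR; rewrite inE => /connectP[q kq ->]; apply: path_connect_induced.
  move=> x; rewrite in_setU1 => xq; apply/orP; right.
  case/splitPl: xq kq => q1 q2 <-; rewrite cat_path => /andP[kq1 _].
  by rewrite inE; apply/connectP; exists q1.
by apply: sub_path kq; apply: induced_subrel.
Qed.

End CutSides.

Lemma btree_path_cut_side (T : finType) (e : rel T) (B1 B2 : {set T}) y p :
  symmetric e -> irreflexive e -> is_block e B1 -> y \in B1 ->
  path (btree_adj e) (inl B1) p -> uniq (inl B1 :: p) -> last (inl B1) p = inl B2 ->
  inr y \in p ->
  exists H : {set T}, [/\ cut_side e y H, B1 \subset H, B2 \subset y |: ~: H
  & forall w, w \in y |: ~: H -> connect (induced e (y |: ~: H)) y w].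
Proof.
move=> e_sym e_irr blB1 yB1 B1p p_uniq p_last yp.
case/splitPr: yp B1p p_uniq p_last => p1 p2.
rewrite cat_path last_cat /= mem_cat cat_uniq inE !negb_or => /and3P[_ _ yp2].
case/andP=> /and3P[_ _ B1_p2] /and4P[_ _ y_p2 _] p2_last.
case: p2 yp2 B1_p2 y_p2 p2_last => [//|[C|//] p2] /= /andP[/and3P[blC _ yC] Cp2].
rewrite !inE !negb_or => /andP[B1C _] /andP[_ y_p2] p2_last.
have [biC _] := andP blC; have [k kC eyk] := biconnected_neighbour biC yC.
have C_sub := biconnected_sub_branch e_irr eyk biC kC (branch_root e y k).
have B2_sub := branch_btree_path e_irr eyk C_sub Cp2 y_p2 p2_last.
exists (~: branch e y k); rewrite setCK; split.
- exact: branch_cut_side.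
- apply/subsetP => x xB1; rewrite inE.
  have [->|xy] := eqVneq x y; first exact: pole_notin_branch.
  have ky := irreflexive_neq e_irr eyk.
  rewrite inE; apply: (@blocks_separated _ _ e_sym e_irr C B1 y) => //.
  by rewrite eq_sym.
- apply/subsetP => x xB2; rewrite in_setU1; case: eqVneq => //= xy.
  by apply: (subsetP B2_sub); rewrite !inE xy.
by move=> w; apply: branch_connected.
Qed.

(** * Weights carried by odd cycles *)

Section WalkWeights.
Variables (T : finType) (e : rel T).
Hypothesis e_irr : irreflexive e.
Implicit Types (S : {set T}) (x y z v : T) (p s : seq T) (b : bool).

Fixpoint alternating_weight b x p : weight T :=
  if p is z :: p' then b%:R *: indicator [set x; z] + alternating_weight (~~ b) z p' else 0.

Lemma alternating_weight_supported S b x p :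
  path (induced e S) x p -> alternating_weight b x p \in edge_supported e S.
Proof.
elim: p b x => [|z p IH] b x /=; first by rewrite rpred0.
by case/andP=> /and3P[xS zS exz] zp; rewrite rpredD ?rpredZ ?indicator_supported ?IH.
Qed.

Lemma alternating_weight_multiset b x p :
  path e x p -> multiset e (alternating_weight b x p).
Proof.
move=> xp; split=> [|E].
  by apply/alternating_weight_supported/path_induced => // z _; exact: in_setT.
elim: p b x {xp} => [|z p IH] b x /=; rewrite ffunE ?nat_num0 //.
by rewrite rpredD ?IH // weightZE ffunE rpredM ?natr_nat.
Qed.

Lemma vsum_alternating_weight b x s z v : path e x (rcons s z) ->
  vsum v (alternating_weight b x (rcons s z)) =
  (b * (v == x) + count_mem v s + (b (+) odd (size s)) * (v == z))%:R.
Proof.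
have mem_edge u w : e u w -> (v \in [set u; w])%:R = ((v == u) + (v == w))%:R :> rat.
  move=> euw; rewrite !inE; case: eqVneq => [vu|_]; case: eqVneq => [vw|_] //.
  by rewrite -vu vw e_irr in euw.
elim: s b x => [|w s IH] b x /= /andP[exw wp];
  rewrite linearP /= vsum_indicator mem_edge //.
  by rewrite raddf0 addr0 -natrM addbF; congr _%:R; case: b; rewrite ?mul1n ?mul0n ?addn0.
rewrite IH // -natrM -natrD addNb -addbN; congr _%:R.
by rewrite [w == v]eq_sym; case: b => /=; rewrite ?mul1n ?mul0n; lia.
Qed.

Definition walk_weight b y s := alternating_weight b y (rcons s y).

Lemma walk_weight_supported S b y s :
  odd_closed_walk e S (y :: s) -> walk_weight b y s \in edge_supported e S.
Proof. by case/andP=> ys _; apply: alternating_weight_supported. Qed.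

Lemma walk_weight_multiset S b y s :
  odd_closed_walk e S (y :: s) -> multiset e (walk_weight b y s).
Proof.
case/andP=> ys _; apply: alternating_weight_multiset.
by apply: sub_path ys; apply: induced_subrel.
Qed.

Lemma vsum_walk_weight S b y s v : odd_closed_walk e S (y :: s) ->
  vsum v (walk_weight b y s) = (count_mem v s + 2 * (b && (v == y)))%:R.
Proof.
case/andP=> ys /= s_even; rewrite vsum_alternating_weight; last first.
  by apply: sub_path ys; apply: induced_subrel.
by rewrite (negPf s_even) addbF; congr _%:R; case: b; case: (v == y) => /=; lia.
Qed.

End WalkWeights.

Section OddCycleWeights.
Variables (T : finType) (e : rel T) (s : seq T) (w : weight T).
Hypotheses (s_chordless : chordless_cycle_seq e s).
Hypothesis w_supp : w \in edge_supported e [set x in s].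
Implicit Types (x y v : T) (E : {set T}).

Let s_uniq : uniq s. Proof. by case/and4P: s_chordless. Qed.

Lemma supported_cycle_edge E : w E != 0 -> exists2 v, v \in s & E = [set v; next s v].
Proof.
have /edge_supportedP w_edges := w_supp => /w_edges[/gedgeP[x [z [exz ->]]]].
rewrite subUset !sub1set !inE => /andP[xs zs]; case/and4P: s_chordless => _ _ _.
move=> /allP/(_ _ xs)/allP/(_ _ zs)/implyP/(_ exz)/orP[] /eqP eq_next.
  by exists x; rewrite // -eq_next.
by exists z; rewrite // -eq_next setUC.
Qed.

Lemma next_neq_prev v : v \in s -> next s v != prev s v.
Proof.
move=> vs; have [i s' sE] := rot_to vs.
rewrite -(next_rot i s_uniq) -(prev_rot i s_uniq) sE.
have := s_uniq; rewrite -(rot_uniq i) sE; have : (2 < size (rot i s))%N.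
  by rewrite size_rot; case/and4P: s_chordless.
rewrite sE; case: s' {sE} => [|z s'] //; case/lastP: s' => // s' t _ vzt_uniq.
have -> : prev [:: v, z & rcons s' t] v = t.
  by rewrite -(prev_rotr 1 vzt_uniq) -!rcons_cons rotr1_rcons /= eqxx.
by rewrite /= eqxx; case/and3P: vzt_uniq => _; rewrite mem_rcons inE negb_or => /andP[].
Qed.

Lemma vsum_cycle v : v \in s ->
  vsum v w = w [set v; next s v] + w [set prev s v; next s (prev s v)].
Proof.
move=> vs; rewrite next_prev //; set E1 := [set v; _]; set E2 := [set _; v].
have E21 : E2 != E1.
  by apply: contra (next_neq_prev vs) => /eqP; rewrite /E2 setUC => /set2_injr ->.
rewrite /vsum (bigD1 E1) ?set21 //= (bigD1 E2) /= ?set22 ?E21 // big1 ?addr0 // => E.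
case/andP=> /andP[vE EE1] EE2; apply/eqP.
apply: contraTT isT => /supported_cycle_edge[x xs EE].
move: vE EE1 EE2; rewrite EE !inE => /orP[] /eqP vE; first by rewrite /E1 vE eqxx.
by rewrite /E2 vE prev_next // eqxx.
Qed.

Variable y : T.
Hypotheses (s_odd : odd (size s)) (ys : y \in s).
Hypothesis w_balanced : forall v, v != y -> vsum v w = 0.

Lemma cycle_weight_alternates x p : fpath (next s) x p -> x \in s -> y \notin p ->
  w [set last x p; next s (last x p)] = (-1) ^+ size p * w [set x; next s x].
Proof.
elim: p x => [|z p IH] x /=; first by rewrite expr0 mul1r.
case/andP=> /eqP <- nextp xs; rewrite inE negb_or eq_sym => /andP[ny yp].
have nxs : next s x \in s by rewrite mem_next.
rewrite IH // exprSr -mulrA; congr (_ * _); have := vsum_cycle nxs.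
by rewrite w_balanced // prev_next // => /esym/eqP; rewrite addr_eq0 mulN1r => /eqP.
Qed.

Lemma cycle_weights : vsum y w = 2%:R * w [set y; next s y] /\
  forall v, v \in s -> `|w [set v; next s v]| = `|w [set y; next s y]|.
Proof.
have [i s' sE] := rot_to ys.
have : fcycle (next s) (y :: s') by rewrite -sE rot_cycle cycle_next.
rewrite /= rcons_path => /andP[y_path /eqP last_next].
have /andP[ys' _] : uniq (y :: s') by rewrite -sE rot_uniq.
split.
  have prev_y : prev s y = last y s' by rewrite -{1}last_next prev_next.
  rewrite vsum_cycle // prev_y (cycle_weight_alternates y_path ys ys') -signr_odd.
  have := s_odd; rewrite -(size_rot i) sE /= => /negPf ->.
  by rewrite mul1r mulr_natl.
move=> v; rewrite -(mem_rot i) sE => vs; case/splitPl: vs y_path ys' => p1 p2 <-.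
rewrite cat_path mem_cat negb_or => /andP[y_p1 _] /andP[yp1 _].
by rewrite (cycle_weight_alternates y_p1) // normrM normrX normrN1 expr1n mul1r.
Qed.

End OddCycleWeights.

Section OddChordlessCycles.
Variables (T : finType) (e : rel T) (C : {set T}).
Hypothesis C_odd : odd_chordless_cycle e C.
Implicit Types (S : {set T}) (y z v : T) (w : weight T).

Lemma odd_cycle_cover y a w v : w \in edge_supported e C -> y \in C -> a != 0 ->
  (forall x, vsum x w = a * (x == y)%:R) -> v \in C ->
  exists2 E : {set T}, v \in E & w E != 0.
Proof.
have [s [s_chordless s_odd ->]] := C_odd; rewrite !inE => w_supp ys a0 w_sum vs.
have [|wyE abs_eq] := cycle_weights s_chordless w_supp s_odd ys.
  by move=> x xy; rewrite w_sum (negPf xy) mulr0.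
exists [set v; next s v]; rewrite ?set21 // -normr_eq0 abs_eq // normr_eq0.
by apply: contraNneq a0 => wy0; move: wyE; rewrite w_sum eqxx wy0 mulr1 mulr0 => ->.
Qed.

Lemma odd_cycle_subset S z a w : w \in edge_supported e C -> w \in edge_supported e S ->
  z \in C -> a != 0 -> (forall x, vsum x w = a * (x == z)%:R) -> C \subset S.
Proof.
move=> wC /edge_supportedP wS zC a0 w_sum; apply/subsetP => v vC.
by have [E vE /wS[_ /subsetP]] := odd_cycle_cover wC zC a0 w_sum vC; apply.
Qed.

Lemma odd_cycle_balanced_eq0 w : w \in edge_supported e C -> balanced w -> w = 0.
Proof.
have [s [s_chordless s_odd ->]] := C_odd => w_supp w_bal.
apply/ffunP => E; rewrite [RHS]ffunE; apply/eqP; apply: contraT => wE.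
have [v vs EE] := supported_cycle_edge s_chordless w_supp wE.
have [wv _] := cycle_weights s_chordless w_supp s_odd vs (fun x _ => w_bal x).
by move: wv; rewrite w_bal -EE => /esym/eqP; rewrite mulf_eq0 pnatr_eq0 (negPf wE).
Qed.

Lemma odd_cycle_pole_weight z : irreflexive e -> z \in C ->
  exists2 w, w \in edge_supported e C & forall v, vsum v w = 2%:R * (v == z)%:R.
Proof.
move=> e_irr; have [s [s_chordless s_odd CE]] := C_odd; rewrite CE inE => zs.
have [i r sE] := rot_to zs.
have walk : odd_closed_walk e [set x in s] (z :: r).
  rewrite -sE odd_closed_walk_rot; apply: chordless_odd_closed_walk => // x.
  by rewrite inE.
exists (walk_weight true z r - walk_weight false z r) => [|v].
  by rewrite rpredB // walk_weight_supported.
rewrite raddfB /= !(vsum_walk_weight e_irr _ _ walk) /= -natrM addn0 natrD.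
by rewrite addrAC subrr add0r.
Qed.

Lemma odd_cycle_walk S : C \subset S ->
  exists s, [/\ odd_closed_walk e S s, uniq s, (1 < size s)%N & C = [set x in s]].
Proof.
have [s [s_chordless s_odd CE]] := C_odd => /subsetP CS.
have [s_uniq s_gt2 _ _] := and4P s_chordless; exists s; split=> //; last exact: ltnW.
by apply: chordless_odd_closed_walk => // x xs; apply: CS; rewrite CE inE.
Qed.

End OddChordlessCycles.

(** * The generator straddling a cut vertex *)

Section MarkovFamily.
Variables (T : finType) (e : rel T) (k : nat) (u : 'I_k -> weight T * weight T).
Hypothesis u_markov : markov_family e u.
Implicit Types (S : {set T}) (w : weight T) (p : weight T * weight T) (c : 'I_k -> rat).

Definition markov_span c : weight T := \sum_i c i *: exponent_diff (u i).

Lemma markov_spanB c d : markov_span c - markov_span d = markov_span (fun i => c i - d i).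
Proof. by rewrite /markov_span -sumrB; apply: eq_bigr => i _; rewrite scalerBl. Qed.

Lemma markov_spanD c d : markov_span c + markov_span d = markov_span (fun i => c i + d i).
Proof. by rewrite /markov_span -big_split; apply: eq_bigr => i _; rewrite scalerDl. Qed.

Lemma markov_spanZ (a : rat) c : a *: markov_span c = markov_span (fun i => a * c i).
Proof. by rewrite /markov_span scaler_sumr; apply: eq_bigr => i _; rewrite scalerA. Qed.

Lemma markov_span_delta i : exponent_diff (u i) = markov_span (fun j => (j == i)%:R).
Proof.
rewrite /markov_span (bigD1 i) //= eqxx scale1r big1 ?addr0 // => j /negPf->.
by rewrite scale0r.
Qed.

Lemma markov_span_inj c d : markov_span c = markov_span d -> c =1 d.
Proof.
move=> cd i; have [_ u_free _] := u_markov; apply/eqP; rewrite -subr_eq0; apply/eqP.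
by apply: (u_free (fun j => c j - d j)); rewrite -[LHS]markov_spanB cd subrr.
Qed.

Lemma exponent_diff_balanced p : toric_binomial e p -> balanced (exponent_diff p).
Proof. by case=> _ _ eq_deg v; rewrite raddfB /= eq_deg subrr. Qed.

Lemma exponent_diff_supported p :
  toric_binomial e p -> exponent_diff p \in edge_supported e setT.
Proof. by case=> [[p1T _] [p2T _] _]; rewrite rpredB. Qed.

Lemma markov_diff_balanced i : balanced (exponent_diff (u i)).
Proof. by have [u_bin _ _] := u_markov; apply: exponent_diff_balanced (u_bin i). Qed.

Lemma markov_diff_supported i : exponent_diff (u i) \in edge_supported e setT.
Proof. by have [u_bin _ _] := u_markov; apply: exponent_diff_supported. Qed.

Lemma toric_binomial_supported S p : toric_binomial e p ->
  (forall v, v \notin S -> vsum v p.1 <= 0) -> exponent_diff p \in edge_supported e S.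
Proof.
move=> p_bin p_le; have [p1_multi p2_multi eq_deg] := p_bin.
have /edge_supportedP diffT := exponent_diff_supported p_bin.
apply/edge_supportedP => E diffE; split; first by case: (diffT _ diffE).
apply/subsetP => v vE; apply: contraNT diffE => vS.
have vanish a : multiset e a -> vsum v a <= 0 -> a E = 0.
  move=> a_multi a_le; apply/le_anti; rewrite (le_trans (multiset_le_vsum a_multi vE)) //=.
  by case: a_multi => _ /(_ E)/natr_ge0.
by rewrite !ffunE !vanish ?subrr // -?eq_deg p_le.
Qed.

Lemma integral_supported_binomial S w : w \in edge_supported e S -> balanced w ->
  (forall E, w E \is a Num.int) -> exists p,
  [/\ toric_binomial e p, exponent_diff p = w & forall v, v \notin S -> vsum v p.1 = 0].
Proof.
move=> wS w_bal w_int; pose b : weight T := [ffun E => `|w E|].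
have bS : b \in edge_supported e S.
  apply/edge_supportedP => E; rewrite ffunE normr_eq0.
  by move/edge_supportedP: wS; apply.
have b_multi : multiset e b.
  by split=> [|E]; [apply: edge_supportedS bS|rewrite ffunE natr_norm_int].
exists (w + b, b); split=> [||v vS]; last 2 first.
- by rewrite /exponent_diff /= addrK.
- by rewrite (@vsum_outside _ e S) // rpredD.
split=> [|//|v]; last by rewrite raddfD /= w_bal add0r.
split=> [|E]; first by rewrite rpredD // (edge_supportedS (subsetT S)).
rewrite !ffunE natrEint rpredD ?w_int ?intr_nat ?natr_norm_int //=.
by rewrite -[w E in X in X + _]opprK addrC subr_ge0 -normrN ler_norm.
Qed.

Lemma supported_span S w : w \in edge_supported e S -> balanced w ->
  exists2 c, w = markov_span c
    & forall i, c i != 0 -> exponent_diff (u i) \in edge_supported e S.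
Proof.
move=> wS w_bal; have [N N0 Nw] := common_denominator w.
have [|v|E|p [p_bin p_diff p_deg]] := @integral_supported_binomial S (N *: w).
- by rewrite rpredZ.
- by rewrite linearZ /= w_bal mulr0.
- by rewrite weightZE.
have [u_bin _ u_span] := u_markov; have [c cE c_le] := u_span _ p_bin.
exists (fun i => N^-1 * c i) => [|i].
  by rewrite -markov_spanZ -[markov_span c]cE p_diff scalerK.
rewrite mulf_eq0 negb_or => /andP[_ /c_le le_deg].
by apply: toric_binomial_supported => // v /p_deg <-.
Qed.

Lemma supported_span_sub S S1 S2 w1 w2 :
  w1 \in edge_supported e S1 -> balanced w1 -> w2 \in edge_supported e S2 -> balanced w2 ->
  w1 - w2 \in edge_supported e S -> exists2 c, w1 - w2 = markov_span c
  & forall i, c i != 0 -> exponent_diff (u i) \in edge_supported e (S :&: S1)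
                       \/ exponent_diff (u i) \in edge_supported e (S :&: S2).
Proof.
move=> w1S w1_bal w2S w2_bal diffS.
have diff_bal : balanced (w1 - w2) by move=> v; rewrite raddfB /= w1_bal w2_bal subrr.
have [c1 w1E c1_supp] := supported_span w1S w1_bal.
have [c2 w2E c2_supp] := supported_span w2S w2_bal.
have [c diffE c_supp] := supported_span diffS diff_bal; exists c => // i ci.
have cE : c i = c1 i - c2 i.
  by apply: (@markov_span_inj c (fun j => c1 j - c2 j)); rewrite -markov_spanB -w1E -w2E.
have [c1i|c1i] := eqVneq (c1 i) 0; last first.
  by left; apply: edge_supportedI; [apply: c_supp|apply: c1_supp].
right; apply: edge_supportedI; first exact: c_supp.
by apply: c2_supp; move: ci; rewrite cE c1i sub0r oppr_eq0.
Qed.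

End MarkovFamily.

Section Straddling.
Variables (T : finType) (e : rel T).
Hypotheses (e_sym : symmetric e) (e_irr : irreflexive e).
Variables (y : T) (H : {set T}).
Hypothesis H_side : cut_side e y H.
Implicit Types (E : {set T}) (v : T) (w : weight T) (p : weight T * weight T).

Lemma gedge_side E : E \in gedges e -> E \subset H \/ E \subset y |: ~: H.
Proof.
have [yH sideH] := H_side; case/gedgeP=> x [z [exz ->]]; rewrite !subUset !sub1set !inE.
have [xH|xH] := boolP (x \in H); have [zH|zH] := boolP (z \in H); rewrite ?orbT; auto.
  by right; rewrite (sideH _ _ exz xH zH) eqxx.
by rewrite e_sym in exz; right; rewrite (sideH _ _ exz zH xH) eqxx.
Qed.

Lemma restrict_other_side w : w \in edge_supported e (y |: ~: H) -> restrict H w = 0.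
Proof.
move=> /edge_supportedP w_supp; apply/ffunP => E; rewrite !ffunE; case: ifP => // EH.
apply/eqP; apply: contraT => /w_supp[/(card_gedge e_irr) E_card EH'].
have /subset_leq_card : E \subset [set y].
  apply/subsetP => x xE; have := subsetP EH' _ xE; rewrite !inE (subsetP EH _ xE) orbF.
  exact.
by rewrite cards1 E_card.
Qed.

Lemma other_side_supported w : w \in edge_supported e setT ->
  w - restrict H w \in edge_supported e (y |: ~: H).
Proof.
move=> /edge_supportedP w_supp; apply/edge_supportedP => E; rewrite !ffunE.
case: ifP => [_|EH]; first by rewrite subrr eqxx.
by rewrite subr0 => /w_supp[Ein _]; split=> //; case: (gedge_side Ein); rewrite // EH.
Qed.

Lemma restrict_balanced w : w \in edge_supported e setT ->
  (forall v, v != y -> vsum v w = 0) -> forall v, v != y -> vsum v (restrict H w) = 0.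
Proof.
move=> w_supp w_bal v vy; have [vH|vH] := boolP (v \in H); last first.
  by apply: vsum_outside vH; apply: restrict_supported w_supp.
rewrite -(w_bal _ vy) -[in RHS](subrK (restrict H w) w) raddfD /=.
rewrite (vsum_outside (other_side_supported w_supp)) ?add0r //.
by rewrite !inE (negPf vy) vH.
Qed.

Definition straddle w : rat := vsum y (restrict H w).

HB.instance Definition _ := GRing.Linear.copy straddle (vsum y \o restrict H).

Lemma straddle_inside w : w \in edge_supported e H -> straddle w = vsum y w.
Proof. by move=> wH; rewrite /straddle (restrict_id wH). Qed.

Lemma straddle_outside w : w \in edge_supported e (y |: ~: H) -> straddle w = 0.
Proof. by move=> wH; rewrite /straddle (restrict_other_side wH) raddf0. Qed.

Lemma straddle_le_vsum w : multiset e w -> 0 <= straddle w <= vsum y w.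
Proof.
move=> [_ w_nat]; rewrite /straddle /vsum; apply/andP; split.
  by apply: sumr_ge0 => E _; rewrite ffunE; case: ifP => // _; apply/natr_ge0.
by apply: ler_sum => E _; rewrite ffunE; case: ifP => // _; apply/natr_ge0.
Qed.

Lemma restrict_exponent_diff_le p v E : toric_binomial e p -> v \in E ->
  `|restrict H (exponent_diff p) E| <= vsum v p.1.
Proof.
move=> [a_multi b_multi eq_deg] vE; have a_le := multiset_le_vsum a_multi vE.
have := multiset_le_vsum b_multi vE; rewrite -eq_deg => b_le.
case: a_multi b_multi => [_ /(_ E)/natr_ge0 a_ge0] [_ /(_ E)/natr_ge0 b_ge0].
by rewrite !ffunE ler_norml; case: ifP => _; apply/andP; split; lra.
Qed.

Lemma straddle_even p : toric_binomial e p -> vsum y p.1 <= 2%:R ->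
  straddle (exponent_diff p) != 0 ->
  straddle (exponent_diff p) = 2%:R \/ straddle (exponent_diff p) = - 2%:R.
Proof.
move=> p_bin p_le; set w := restrict H (exponent_diff p).
have [p1_multi p2_multi eq_deg] := p_bin.
have wH : w \in edge_supported e H.
  exact/restrict_supported/exponent_diff_supported/p_bin.
have w_bal v : v != y -> vsum v w = 0.
  apply: restrict_balanced; first exact: exponent_diff_supported.
  by move=> x _; apply: (exponent_diff_balanced p_bin).
have /intrP[n nE] : \sum_E w E \is a Num.int.
  apply: rpred_sum => E _; rewrite !ffunE; case: ifP => // _.
  by case: p1_multi p2_multi => [_ a_nat] [_ b_nat]; rewrite rpredB // intr_nat.
have := sum_vsum e_irr wH; rewrite (bigD1 y) //= big1 // addr0 nE -/(straddle _) => strE.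
have := straddle_le_vsum p1_multi; have := straddle_le_vsum p2_multi.
have : straddle (exponent_diff p) = straddle p.1 - straddle p.2 by rewrite raddfB.
rewrite -eq_deg strE => diffE /andP[b_ge0 b_le] /andP[a_ge0 a_le].
have n_le : n%:~R <= 1%:~R :> rat by rewrite /=; lra.
have n_ge : (-1)%:~R <= n%:~R :> rat by rewrite /=; lra.
rewrite mulf_eq0 pnatr_eq0 intr_eq0 /= => n0; rewrite !ler_int in n_le n_ge.
have [->|->] : n = 1 \/ n = -1 by lia.
  by left; rewrite mulr1.
by right; rewrite mulrN1.
Qed.

Lemma two_sided_walk_binomial s t :
  based_odd_walk e H y s -> based_odd_walk e (y |: ~: H) y t -> exists p,
  [/\ toric_binomial e p, straddle (exponent_diff p) != 0
    & forall v, vsum v p.1 = (count_mem v s + count_mem v t + 2 * (v == y))%:R].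
Proof.
move=> /andP[ws ys] /andP[wt yt].
pose a c := walk_weight c y s + walk_weight (~~ c) y t.
have vsum_a c v : vsum v (a c) = (count_mem v s + count_mem v t + 2 * (v == y))%:R.
  rewrite raddfD /= (vsum_walk_weight e_irr _ _ ws) (vsum_walk_weight e_irr _ _ wt).
  by rewrite -natrD; congr _%:R; case: c => /=; lia.
have straddle_a c : straddle (a c) = (2 * c)%:R.
  rewrite raddfD /= straddle_inside ?straddle_outside ?walk_weight_supported // addr0.
  by rewrite (vsum_walk_weight e_irr _ _ ws) (count_memPn ys) eqxx andbT.
have a_multi c : multiset e (a c).
  exact: multisetD (walk_weight_multiset _ ws) (walk_weight_multiset _ wt).
exists (a true, a false); split=> [|| v]; rewrite ?vsum_a //.
  by split=> [||v]; [exact: a_multi | exact: a_multi | rewrite !vsum_a].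
by rewrite raddfB /= !straddle_a subr0 pnatr_eq0.
Qed.

Section MarkovStraddling.
Variables (k : nat) (u : 'I_k -> weight T * weight T).
Hypothesis u_markov : markov_family e u.

Let str i := straddle (exponent_diff (u i)).

Lemma nonstraddling_span w : w \in edge_supported e setT -> balanced w -> straddle w = 0 ->
  exists2 c, w = markov_span u c & forall i, str i != 0 -> c i = 0.
Proof.
move=> w_supp w_bal w_str; set w1 := restrict H w; set w2 := w - w1.
have w1_bal : balanced w1.
  by move=> v; have [->//|vy] := eqVneq v y; apply: restrict_balanced.
have w2_bal : balanced w2 by move=> v; rewrite raddfB /= w_bal w1_bal subrr.
have [c1 w1E c1_supp] := supported_span u_markov (restrict_supported H w_supp) w1_bal.
have [c2 w2E c2_supp] := supported_span u_markov (other_side_supported w_supp) w2_bal.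
have u_bal := markov_diff_balanced u_markov.
exists (fun i => c1 i + c2 i) => [|i str_i].
  by rewrite -markov_spanD -w1E -w2E addrC subrK.
have -> : c1 i = 0.
  by apply: contraNeq str_i => /c1_supp/straddle_inside; rewrite /str => ->; rewrite u_bal.
rewrite add0r; apply: contraNeq str_i => /c2_supp/straddle_outside.
by rewrite /str => ->.
Qed.

Lemma straddling_unique i j : str i != 0 -> str j != 0 -> i = j.
Proof.
move=> str_i str_j; apply/eqP; apply: contraT => ij.
pose w := str j *: exponent_diff (u i) - str i *: exponent_diff (u j).
have [|v||c wE c0] := @nonstraddling_span w.
- by rewrite rpredB ?rpredZ ?(markov_diff_supported u_markov).
- by rewrite raddfB /= !linearZ /= !(markov_diff_balanced u_markov) !mulr0 subrr.
- by rewrite raddfB /= !linearZ /= mulrC subrr.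
have wE' : w = markov_span u (fun l => str j * (l == i)%:R - str i * (l == j)%:R).
  by rewrite -markov_spanB -!markov_spanZ -!markov_span_delta.
have := markov_span_inj u_markov (etrans (esym wE') wE) i.
by rewrite c0 // eqxx (negPf ij) mulr1 mulr0 subr0 => str_j0; rewrite str_j0 eqxx in str_j.
Qed.

Lemma straddling_below p : toric_binomial e p -> straddle (exponent_diff p) != 0 ->
  exists2 i, str i != 0 & forall v, vsum v (u i).1 <= vsum v p.1.
Proof.
move=> p_bin; have [_ _ u_span] := u_markov; have [c -> c_le] := u_span _ p_bin.
move=> str_p; apply: contrapT => no; case/eqP: str_p.
rewrite raddf_sum big1 // => i _ /=; rewrite linearZ /=.
have [->|/c_le le_i] := eqVneq (c i) 0; first exact: mul0r.
have [->|str_i] := eqVneq (straddle (exponent_diff (u i))) 0; first exact: mulr0.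
by case: no; exists i.
Qed.

Lemma exists_straddling s t :
  based_odd_walk e H y s -> based_odd_walk e (y |: ~: H) y t -> exists i, str i != 0.
Proof.
move=> ws wt; have [p [p_bin p_str _]] := two_sided_walk_binomial ws wt.
by have [i str_i _] := straddling_below p_bin p_str; exists i.
Qed.

Lemma straddling_le_walk i s t v : str i != 0 ->
  based_odd_walk e H y s -> based_odd_walk e (y |: ~: H) y t ->
  vsum v (u i).1 <= (count_mem v s + count_mem v t + 2 * (v == y))%:R.
Proof.
move=> str_i ws wt; have [p [p_bin p_str <-]] := two_sided_walk_binomial ws wt.
have [j str_j le_j] := straddling_below p_bin p_str.
by rewrite (straddling_unique str_i str_j).
Qed.

End MarkovStraddling.
End Straddling.

(* Up to sign, the restriction to a side of [y] of the generator straddling [y]. *)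
Definition pole_weight (T : finType) (e : rel T) (S : {set T}) (y : T) (w : weight T) :=
  [/\ w \in edge_supported e setT, forall v, vsum v w = 2%:R * (v == y)%:R
    & forall s v (E : {set T}), based_odd_walk e S y s -> v \in E -> v != y ->
        `|w E| <= (count_mem v s)%:R].

Lemma exists_pole_weight (T : finType) (e : rel T) (H : {set T}) y k
    (u : 'I_k -> weight T * weight T) s0 t :
  symmetric e -> irreflexive e -> markov_family e u -> cut_side e y H ->
  based_odd_walk e H y s0 -> based_odd_walk e (y |: ~: H) y t ->
  exists w, pole_weight e H y w.
Proof.
move=> e_sym e_irr u_markov H_side w_s0 wt.
have [i str_i] := exists_straddling e_irr u_markov w_s0 wt.
have [u_bin _ _] := u_markov; have /andP[wt_walk yt] := wt.
have i_le s v (ws : based_odd_walk e H y s) :=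
  straddling_le_walk e_sym e_irr H_side u_markov v str_i ws wt.
pose w := restrict H (exponent_diff (u i)).
have w_supp : w \in edge_supported e H.
  exact: restrict_supported (markov_diff_supported u_markov i).
have w_bal v : v != y -> vsum v w = 0.
  apply: (restrict_balanced e_sym H_side) => [|x _]; first exact: markov_diff_supported.
  exact: (markov_diff_balanced u_markov).
have w_le s v (E : {set T}) : based_odd_walk e H y s -> v \in E -> v != y ->
    `|w E| <= (count_mem v s)%:R.
  move=> ws vE vy; have [vH|vH] := boolP (v \in H); last first.
    by rewrite (edge_supported_outside w_supp vH vE) normr0.
  have vt : v \notin t.
    apply/negP => vt; have := odd_closed_walk_subset wt_walk (_ : v \in y :: t).
    by rewrite !inE vt orbT (negPf vy) vH => /(_ isT).
  apply: le_trans (restrict_exponent_diff_le H (u_bin i) vE) _.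
  by have := i_le s v ws; rewrite (count_memPn vt) (negPf vy) !addn0.
have signed (c : rat) : `|c| = 1 -> c * vsum y w = 2%:R -> pole_weight e H y (c *: w).
  move=> c1 cw; split=> [|v|s v E ws vE vy].
  - by rewrite rpredZ // (edge_supportedS (subsetT H)).
  - by rewrite linearZ /=; case: eqVneq => [->|/w_bal->]; rewrite ?cw ?mulr1 ?mulr0.
  - by rewrite weightZE normrM c1 mul1r w_le.
have i_le2 : vsum y (u i).1 <= 2%:R.
  have /andP[_ ys0] := w_s0; rewrite (le_trans (i_le s0 y w_s0)) //.
  by rewrite (count_memPn ys0) (count_memPn yt) eqxx.
have [str2|str2] := straddle_even e_sym e_irr H_side (u_bin i) i_le2 str_i.
  by exists (1 *: w); apply: signed; rewrite ?normr1 // mul1r.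
by exists (-1 *: w); apply: signed; rewrite ?normrN1 // mulN1r [vsum y w]str2 opprK.
Qed.

Lemma pole_weightS (T : finType) (e : rel T) (S S' : {set T}) y w :
  S \subset S' -> pole_weight e S' y w -> pole_weight e S y w.
Proof.
by move=> sub [w_supp w_sum w_le]; split=> // s v E /(based_odd_walkS sub)/w_le; apply.
Qed.

Section PoleWeight.
Variables (T : finType) (e : rel T).
Hypotheses (e_sym : symmetric e) (e_irr : irreflexive e).
Variables (B : {set T}) (y : T) (w : weight T).
Hypotheses (B_bi : biconnected e B) (yB : y \in B) (w_pole : pole_weight e B y w).
Implicit Types (C E : {set T}) (v z : T).

Lemma pole_weight_le1 C v E : odd_chordless_cycle e C -> C \subset B ->
  v \in E -> v != y -> `|w E| <= (v \in C)%:R.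
Proof.
move=> C_odd CB vE vy; have [s [ws s_uniq s_gt1 ->]] := odd_cycle_walk C_odd CB.
have [d bd d_le] := odd_closed_walk_avoiding e_sym B_bi yB ws s_uniq s_gt1 vy.
have [_ _ w_le] := w_pole; rewrite inE (le_trans (w_le _ _ _ bd vE vy)) //.
by rewrite ler_nat.
Qed.

Lemma pole_weight_mem C v E : odd_chordless_cycle e C -> C \subset B ->
  v \in E -> v != y -> w E != 0 -> v \in C.
Proof.
move=> C_odd CB vE vy; apply: contraNT => vC.
by have := pole_weight_le1 C_odd CB vE vy; rewrite (negPf vC) normr_le0.
Qed.

Lemma pole_weight_supported C : odd_chordless_cycle e C -> C \subset B ->
  w \in edge_supported e (y |: C).
Proof.
move=> C_odd CB; have [/edge_supportedP w_supp _ _] := w_pole.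
apply/edge_supportedP => E wE; split; first by case: (w_supp _ wE).
apply/subsetP => v vE; rewrite in_setU1; case: eqVneq => //= vy.
exact: pole_weight_mem C_odd CB vE vy wE.
Qed.

(* The weight at [y] is 2, while each edge at [y] has weight at most 1. *)
Lemma exists_common_pole_neighbours C0 : odd_chordless_cycle e C0 -> C0 \subset B ->
  exists z1 z2, [/\ z1 != z2, e y z1, e y z2
  & forall C, odd_chordless_cycle e C -> C \subset B -> z1 \in C /\ z2 \in C].
Proof.
move=> C0_odd C0B; have [/edge_supportedP w_supp w_sum _] := w_pole.
have neq_pole z : e y z -> z != y by apply: irreflexive_neq.
have edge_at E : w E != 0 -> y \in E -> exists2 z, e y z & E = [set y; z].
  by move=> /w_supp[Ein _]; apply: gedge_neighbour.
have [E1 yE1 wE1] : exists2 E : {set T}, y \in E & w E != 0.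
  apply: contrapT => no; have := w_sum y; rewrite eqxx /vsum big1 => [|E yE].
    by move/eqP; rewrite mulr1 eq_sym pnatr_eq0.
  by apply/eqP; apply: contraT => wE; case: no; exists E.
have [z1 eyz1 E1E] := edge_at _ wE1 yE1.
have [E2 [yE2 E21 wE2]] : exists E2 : {set T}, [/\ y \in E2, E2 != E1 & w E2 != 0].
  apply: contrapT => no; have := w_sum y; rewrite eqxx /vsum (bigD1 E1) //= big1 => [|E].
    rewrite addr0 => wE1_2; have z1E1 : z1 \in E1 by rewrite E1E set22.
    have := pole_weight_le1 C0_odd C0B z1E1 (neq_pole _ eyz1).
    by rewrite wE1_2 mulr1 normr_nat ler_nat; case: (_ \in _).
  by case/andP=> yE EE1; apply/eqP; apply: contraT => wE; case: no; exists E.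
have [z2 eyz2 E2E] := edge_at _ wE2 yE2.
exists z1, z2; split=> //; first by apply: contraNneq E21 => z12; rewrite E2E -z12 -E1E.
move=> C C_odd CB; split.
  by apply: (pole_weight_mem C_odd CB _ (neq_pole _ eyz1) wE1); rewrite E1E set22.
by apply: (pole_weight_mem C_odd CB _ (neq_pole _ eyz2) wE2); rewrite E2E set22.
Qed.

Lemma exists_odd_cycle_through_pole : ~ bipartite_in e B ->
  exists C, [/\ odd_chordless_cycle e C, C \subset B & y \in C].
Proof.
move=> B_nb; have connB := biconnected_connected B_bi.
have of_shortest s : shortest_odd_closed_walk e B s ->
    odd_chordless_cycle e [set x in s] /\ [set x in s] \subset B.
  move=> s_short; have [ws _] := s_short; split.
    exists s; split=> //; first exact: shortest_odd_closed_walk_chordless s_short.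
    by case/andP: ws.
  by apply/subsetP => x; rewrite inE; apply: odd_closed_walk_subset ws _.
have [s s_short] := exists_shortest_odd_closed_walk e_sym connB B_nb.
have [C_odd CB] := of_shortest _ s_short.
have [z1 [z2 [z12 eyz1 eyz2 /(_ _ C_odd CB)]]] := exists_common_pole_neighbours C_odd CB.
rewrite !inE => -[z1s z2s]; have [ws s_min] := s_short.
have [d wd d_le] :=
  odd_closed_walk_through_common_neighbour e_sym ws yB z1s z2s z12 eyz1 eyz2.
have [|d_odd dB] := of_shortest (y :: d).
  by split=> // s' /s_min; apply: leq_trans d_le.
by exists [set x in y :: d]; split; rewrite // !inE eqxx.
Qed.

Lemma odd_cycle_through_pole C : odd_chordless_cycle e C -> C \subset B -> y \in C ->
  C = [set v | [exists E : {set T}, (v \in E) && (w E != 0)]].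
Proof.
move=> C_odd CB yC; have := pole_weight_supported C_odd CB.
have -> : y |: C = C by apply/setUidPr; rewrite sub1set.
move=> w_supp; have [_ w_sum _] := w_pole; apply/setP => v; rewrite inE.
apply/idP/existsP => [vC|[E /andP[vE wE]]].
  have [//|E vE wE] := odd_cycle_cover C_odd w_supp yC _ w_sum vC.
  by exists E; rewrite vE.
by have /edge_supportedP/(_ _ wE)[_ /subsetP] := w_supp; apply.
Qed.

Lemma odd_cycle_through_pole_unique C C' : odd_chordless_cycle e C ->
  odd_chordless_cycle e C' -> C \subset B -> C' \subset B -> y \in C -> y \in C' -> C = C'.
Proof.
move=> C_odd C'_odd CB C'B yC yC'.
by rewrite (odd_cycle_through_pole C_odd CB yC) (odd_cycle_through_pole C'_odd C'B yC').
Qed.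

Lemma exists_pole_neighbour C : odd_chordless_cycle e C -> C \subset B ->
  exists2 z, z \in C & e y z.
Proof.
move=> C_odd CB; have [z1 [z2 [_ eyz1 _ /(_ _ C_odd CB)[z1C _]]]] :=
  exists_common_pole_neighbours C_odd CB.
by exists z1.
Qed.

Lemma odd_cycle_pole_relation C z c : odd_chordless_cycle e C -> C \subset B -> z \in C ->
  e y z -> c \in edge_supported e C -> (forall v, vsum v c = 2%:R * (v == z)%:R) ->
  let r := 2%:R *: indicator [set y; z] - w - c in
  r \in edge_supported e (y |: C) /\ balanced r.
Proof.
move=> C_odd CB zC eyz c_supp c_sum; have [_ w_sum _] := w_pole; split=> [|v].
  rewrite !rpredB ?rpredZ ?pole_weight_supported //.
    by rewrite indicator_supported // !inE ?eqxx ?zC ?orbT.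
  by rewrite (edge_supportedS (subsetUr _ _)).
rewrite !raddfB /= linearZ /= vsum_indicator w_sum c_sum !inE.
have [->|_] := eqVneq v y; last by case: (v == z); rewrite !(mulr0, mulr1, subr0, subrr).
by rewrite eq_sym (negPf (irreflexive_neq e_irr eyz)) mulr1 mulr0 subr0 subrr.
Qed.

(* [c' - c] is the difference of two relations, one on [C] and [y], one on [C'] and
   [y]; the generators involved live on [C] or on [C'], and so vanish. *)
Lemma odd_cycle_pole_weight_unique k (u : 'I_k -> weight T * weight T) C C' z c c' :
  markov_family e u -> odd_chordless_cycle e C -> odd_chordless_cycle e C' ->
  C \subset B -> C' \subset B -> y \notin C -> y \notin C' ->
  z \in C -> z \in C' -> e y z ->
  c \in edge_supported e C -> c' \in edge_supported e C' ->
  (forall v, vsum v c = 2%:R * (v == z)%:R) -> (forall v, vsum v c' = 2%:R * (v == z)%:R) ->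
  c' = c.
Proof.
move=> u_markov C_odd C'_odd CB C'B yC yC' zC zC' eyz c_supp c'_supp c_sum c'_sum.
have [r_supp r_bal] := odd_cycle_pole_relation C_odd CB zC eyz c_supp c_sum.
have [r'_supp r'_bal] := odd_cycle_pole_relation C'_odd C'B zC' eyz c'_supp c'_sum.
set x := 2%:R *: _ - w in r_supp r_bal r'_supp r'_bal.
have relE : x - c - (x - c') = c' - c by rewrite opprB addrC subrKA.
have capU (D D' : {set T}) : y \notin D -> y \notin D' -> (D :|: D') :&: (y |: D) = D.
  move=> yD yD'; apply/setP => v; rewrite !inE; case: eqVneq => [->|_] /=.
    by rewrite (negPf yD) (negPf yD').
  by case: (v \in D); rewrite ?andbF.
apply/eqP; rewrite -subr_eq0; apply/eqP.
have [|d] := supported_span_sub u_markov r_supp r_bal r'_supp r'_bal (S := C :|: C').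
  rewrite relE rpredB ?(edge_supportedS (subsetUr _ _) c'_supp) //.
  exact: edge_supportedS (subsetUl _ _) c_supp.
rewrite relE => -> d_supp; rewrite /markov_span big1 // => i _.
have u_bal := markov_diff_balanced u_markov i.
have [->|/d_supp] := eqVneq (d i) 0; first by rewrite scale0r.
rewrite capU // setUC capU // => -[] u_supp.
  by rewrite (odd_cycle_balanced_eq0 C_odd u_supp u_bal) scaler0.
by rewrite (odd_cycle_balanced_eq0 C'_odd u_supp u_bal) scaler0.
Qed.

Lemma odd_cycle_avoiding_pole_unique k (u : 'I_k -> weight T * weight T) C C' :
  markov_family e u -> odd_chordless_cycle e C -> odd_chordless_cycle e C' ->
  C \subset B -> C' \subset B -> y \notin C -> y \notin C' -> C = C'.
Proof.
move=> u_markov C_odd C'_odd CB C'B yC yC'.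
have [z [z' [_ eyz _ z_mem]]] := exists_common_pole_neighbours C_odd CB.
have [[zC _] [zC' _]] := (z_mem _ C_odd CB, z_mem _ C'_odd C'B).
have [c c_supp c_sum] := odd_cycle_pole_weight C_odd e_irr zC.
have [c' c'_supp c'_sum] := odd_cycle_pole_weight C'_odd e_irr zC'.
have cc' : c' = c.
  exact: odd_cycle_pole_weight_unique u_markov C_odd C'_odd CB C'B yC yC' zC zC' eyz
    c_supp c'_supp c_sum c'_sum.
rewrite cc' in c'_supp; apply/eqP; rewrite eqEsubset.
by rewrite (odd_cycle_subset C_odd c_supp c'_supp zC _ c_sum)
           ?(odd_cycle_subset C'_odd c'_supp c_supp zC' _ c_sum).
Qed.

End PoleWeight.

Section TwoNonbipartiteBlocks.
Variables (T : finType) (e : rel T).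
Hypotheses (e_sym : symmetric e) (e_irr : irreflexive e).
Variables (k : nat) (u : 'I_k -> weight T * weight T).
Hypothesis u_markov : markov_family e u.
Variables (B1 B2 : {set T}) (y : T) (p : seq ({set T} + T)).
Hypotheses (B1_block : is_block e B1) (B2_block : is_block e B2).
Hypotheses (B1_nb : ~ bipartite_in e B1) (B2_nb : ~ bipartite_in e B2).
Hypotheses (p_path : path (btree_adj e) (inl B1) p) (p_uniq : uniq (inl B1 :: p)).
Hypotheses (p_end : last (inl B1) p = inl B2) (yB1 : y \in B1) (yp : inr y \in p).
Implicit Types C : {set T}.

Let B1_bi : biconnected e B1. Proof. by case/andP: B1_block. Qed.
Let B2_bi : biconnected e B2. Proof. by case/andP: B2_block. Qed.

Lemma exists_block_pole_weight : exists w, pole_weight e B1 y w.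
Proof.
have [H [H_side B1H B2H H_conn]] :=
  btree_path_cut_side e_sym e_irr B1_block yB1 p_path p_uniq p_end yp.
have [conn1 conn2] := (biconnected_connected B1_bi, biconnected_connected B2_bi).
have [[|z1 s1] //= ws1] := nonbipartite_odd_closed_walk e_sym conn1 B1_nb.
have [[|z2 s2] //= /(odd_closed_walkS B2H) ws2] :=
  nonbipartite_odd_closed_walk e_sym conn2 B2_nb.
have [z1B1 z2H] := (odd_closed_walk_subset ws1 (mem_head _ _),
                    odd_closed_walk_subset ws2 (mem_head _ _)).
have [s ws] :=
  connect_based_odd_walk e_sym ws1 (mem_head _ _) (connected_inP conn1 _ _ yB1 z1B1).
have [t wt] := connect_based_odd_walk e_sym ws2 (mem_head _ _) (H_conn _ z2H).
have [w w_pole] :=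
  exists_pole_weight e_sym e_irr u_markov H_side (based_odd_walkS B1H ws) wt.
by exists w; apply: pole_weightS w_pole.
Qed.

Lemma odd_cycles_of_block :
  [/\ forall C1 C2 C3 : {set T}, odd_chordless_cycle e C1 ->
        odd_chordless_cycle e C2 -> odd_chordless_cycle e C3 ->
        C1 \subset B1 -> C2 \subset B1 -> C3 \subset B1 ->
        C1 = C2 \/ C1 = C3 \/ C2 = C3,
      exists C : {set T}, [/\ odd_chordless_cycle e C, C \subset B1, y \in C &
        forall C', odd_chordless_cycle e C' -> C' \subset B1 -> y \in C' -> C' = C]
    & forall C, odd_chordless_cycle e C -> C \subset B1 -> y \notin C ->
        exists2 z, z \in C & e y z].
Proof.
have [w w_pole] := exists_block_pole_weight.
have through := odd_cycle_through_pole_unique e_sym B1_bi yB1 w_pole.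
have avoiding C C' := @odd_cycle_avoiding_pole_unique _ _ e_sym e_irr _ _ _ B1_bi yB1 w_pole
  _ _ C C' u_markov.
split=> [C1 C2 C3 C1_odd C2_odd C3_odd C1B C2B C3B||C C_odd CB _].
- have [y1|y1] := boolP (y \in C1); have [y2|y2] := boolP (y \in C2);
    have [y3|y3] := boolP (y \in C3);
    by [ left; apply: through | left; apply: avoiding | right; left; apply: through
       | right; left; apply: avoiding | right; right; apply: through
       | right; right; apply: avoiding ].
- have [C [C_odd CB yC]] :=
    exists_odd_cycle_through_pole e_sym e_irr B1_bi yB1 w_pole B1_nb.
  by exists C; split=> // C' C'_odd C'B yC'; apply: through.
exact: (exists_pole_neighbour e_sym e_irr B1_bi yB1 w_pole C_odd CB).
Qed.

End TwoNonbipartiteBlocks.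

Lemma rev_uniq_path (X : eqType) (r : rel X) x p : symmetric r ->
  path r x p -> uniq (x :: p) -> exists q,
  [/\ path r (last x p) q, uniq (last x p :: q), last (last x p) q = x
    & last x p :: q =i x :: p].
Proof.
move=> r_sym xp xp_uniq; exists (rev (belast x p)).
have revE : last x p :: rev (belast x p) = rev (x :: p) by rewrite [in RHS]lastI rev_rcons.
split=> [|||z]; rewrite ?revE ?rev_uniq ?mem_rev //.
  by rewrite rev_path; apply: sub_path xp => a b; rewrite r_sym.
by rewrite -[LHS]/(last (last x p) (last x p :: _)) revE rev_cons last_rcons.
Qed.

Lemma btree_adj_sym (T : finType) (e : rel T) : symmetric (btree_adj e).
Proof. by move=> [B|v] [C|w]. Qed.

Theorem theorem6p4 (K : fieldType) (T : finType) (e : rel T)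
  (e_sym : symmetric e) (e_irr : irreflexive e)
  (G_conn : gconnected e)
  (G_CI : graph_CI e K)
  (B1 B2 : {set T})
  (B1_block : is_block e B1) (B2_block : is_block e B2) (B12 : B1 != B2)
  (B1_nb : ~ bipartite_in e B1) (B2_nb : ~ bipartite_in e B2)
  (only_two : forall B, is_block e B -> ~ bipartite_in e B -> B = B1 \/ B = B2)
  (y12 y21 : T)
  (p : seq ({set T} + T))
  (p_path : path (btree_adj e) (inl B1) p)
  (p_uniq : uniq (inl B1 :: p))
  (p_end : last (inl B1) p = inl B2)
  (y12_cut : is_cut e y12) (y12_B1 : y12 \in B1) (y12_p : inr y12 \in p)
  (y21_cut : is_cut e y21) (y21_B2 : y21 \in B2) (y21_p : inr y21 \in p) :
  (* at most two odd chordless cycles in each of B1, B2 *)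
  (forall C1 C2 C3 : {set T},
     odd_chordless_cycle e C1 -> odd_chordless_cycle e C2 -> odd_chordless_cycle e C3 ->
     C1 \subset B1 -> C2 \subset B1 -> C3 \subset B1 ->
     C1 = C2 \/ C1 = C3 \/ C2 = C3) /\
  (forall C1 C2 C3 : {set T},
     odd_chordless_cycle e C1 -> odd_chordless_cycle e C2 -> odd_chordless_cycle e C3 ->
     C1 \subset B2 -> C2 \subset B2 -> C3 \subset B2 ->
     C1 = C2 \/ C1 = C3 \/ C2 = C3) /\
  (* exactly one odd chordless cycle of B1 through y12, of B2 through y21 *)
  (exists C : {set T}, [/\ odd_chordless_cycle e C, C \subset B1, y12 \in C &
     forall C', odd_chordless_cycle e C' -> C' \subset B1 -> y12 \in C' -> C' = C]) /\
  (exists C : {set T}, [/\ odd_chordless_cycle e C, C \subset B2, y21 \in C &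
     forall C', odd_chordless_cycle e C' -> C' \subset B2 -> y21 \in C' -> C' = C]) /\
  (* any other odd chordless cycle has distance one from the cut vertex *)
  (forall C, odd_chordless_cycle e C -> C \subset B1 -> y12 \notin C ->
     exists2 z, z \in C & e y12 z) /\
  (forall C, odd_chordless_cycle e C -> C \subset B2 -> y21 \notin C ->
     exists2 z, z \in C & e y21 z).
Proof.
have [k [u u_markov]] := graph_markov_basis e_irr G_CI.
have [q] := rev_uniq_path (@btree_adj_sym _ e) p_path p_uniq.
rewrite p_end => -[q_path q_uniq q_end q_mem].
have y21_q : inr y21 \in q by have := q_mem (inr y21); rewrite !inE y21_p orbT.
have [two1 one1 dist1] := odd_cycles_of_block e_sym e_irr u_markov B1_block B2_block
  B1_nb B2_nb p_path p_uniq p_end y12_B1 y12_p.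
have [two2 one2 dist2] := odd_cycles_of_block e_sym e_irr u_markov B2_block B1_block
  B2_nb B1_nb q_path q_uniq q_end y21_B2 y21_q.
by [].
Qed.
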